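(* Let $X,X_1,\dots,X_n$ be independent identically distributed random variables such that $\mathsf P(|X|\le1)=1$ and $\mathsf E X=0$. Then $$\mathsf P\Big(\frac{X_1+\dots+X_n}{\sqrt n}\ge x\Big)\le 2\hat Q_n(x)$$ for all real $x\ge0$, where $\hat Q_n$ is the linear interpolation of the restriction of the function $Q$ to the set $\frac2{\sqrt n}\big(\frac n2-\lfloor\frac n2\rfloor+\mathbb Z\big)$.
   Context: $Z$ denotes a standard normal random variable with density $\varphi(x)=\frac1{\sqrt{2\pi}}e^{-x^2/2}$. The function $Q$ is given, for real $x$, by $Q(x):=\mathsf P(Z>x)+\frac{C\varphi(x)}{9+x^2}$, where $C:=5\sqrt{2\pi e}\,\mathsf P(|Z|<1)$. The linear interpolation of the restriction of $Q$ to the lattice $T:=\frac2{\sqrt n}\big(\frac n2-\lfloor\frac n2\rfloor+\mathbb Z\big)$ is the continuous function on $\mathbb R$ that coincides with $Q$ on $T$ and is affine between each two consecutive points of $T$. *)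

(* Defs.v *)
From HB Require Import structures.
From mathcomp Require Import all_boot all_order all_algebra.
From mathcomp Require Import all_classical all_reals all_analysis.
From mathcomp Require Import zify ring lra.
Set Implicit Arguments.
Unset Strict Implicit.
Unset Printing Implicit Defensive.
Import Order.TTheory GRing.Theory Num.Theory.
Import numFieldNormedType.Exports.
Local Open Scope classical_set_scope.
Local Open Scope ring_scope.

(* The product rule is required for every subfamily J, not just for the whole
   index type. *)
Definition mutually_independent (d : measure_display) (T : measurableType d)
    (R : realType) (P : probability T R) (I : finType)
    (X : I -> {RV P >-> R}) : Prop :=
  forall (J : {set I}) (B : I -> set R),
    (forall i, measurable (B i)) ->
    P [set w | forall i, i \in J -> B i (X i w)] =
      (\prod_(i in J) P (X i @^-1` B i))%E.

Definition identically_distributed (d : measure_display)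
    (T : measurableType d) (R : realType) (P : probability T R) (I : finType)
    (X : I -> {RV P >-> R}) : Prop :=
  forall (i j : I) (B : set R), measurable B ->
    distribution P (X i) B = distribution P (X j) B.

Definition iid (d : measure_display) (T : measurableType d) (R : realType)
    (P : probability T R) (I : finType) (X : I -> {RV P >-> R}) : Prop :=
  mutually_independent X /\ identically_distributed X.

(* The family X, X_1, ..., X_n, with X at index None. *)
Definition ocons (A : Type) (n : nat) (a : A) (s : 'I_n -> A) :
    option 'I_n -> A :=
  fun o => if o is Some i then s i else a.

Section StandardNormal.
Context {R : realType}.
Implicit Types x : R.

Definition std_normal_pdf x : R := normal_pdf 0 1 x.

Lemma std_normal_pdfE x :
  std_normal_pdf x = (Num.sqrt (2 * pi))^-1 * expR (- x ^+ 2 / 2).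
Proof.
rewrite /std_normal_pdf normal_pdfE ?oner_eq0// /normal_peak /normal_fun.
by rewrite expr1n mul1r subr0 mulr_natl.
Qed.

(* The law of Z; it takes finite values, so fine loses nothing below. *)
Definition std_normal_prob (A : set R) : R := fine (normal_prob 0 1 A).

Definition constC : R :=
  5 * Num.sqrt (2 * pi * expR 1) * std_normal_prob [set z | `|z| < 1].

Definition Qfun x : R :=
  std_normal_prob [set z | x < z] +
  constC * std_normal_pdf x / (9 + x ^+ 2).

End StandardNormal.

Section LinearInterpolation.
Context {R : realType}.
Implicit Types (L : set R) (f g : R -> R).

Definition consecutive L (a b : R) : Prop :=
  [/\ L a, L b, a < b & forall t, L t -> ~ (a < t < b)].

Definition linear_interpolation L f g : Prop :=
  [/\ continuous g,
      forall t, L t -> g t = f t &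
      forall a b, consecutive L a b ->
        exists m c : R, forall x, a <= x <= b -> g x = m * x + c].

End LinearInterpolation.

Definition lattice (R : realType) (n : nat) : set R :=
  [set 2 / Num.sqrt n%:R *
       (n%:R / 2 - (Num.floor (n%:R / 2 : R))%:~R + k%:~R) | k in [set: int]].
Arguments lattice : clear implicits.

(* On lattice R n the linear interpolation exists and is unique. *)
Section LatticeInterpolation.
Context {R : realType} (n : nat) (n_gt0 : (0 < n)%N).
Implicit Types (f g : R -> R) (h : int -> R).

Let s : R := 2 / Num.sqrt n%:R.
Let o : R := n%:R / 2 - (Num.floor (n%:R / 2 : R))%:~R.

Let s_gt0 : 0 < s.
Proof. by rewrite divr_gt0// sqrtr_gt0 ltr0n. Qed.

Let polygonal h (u : R) : R :=
  h (Num.floor u) +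
  (u - (Num.floor u)%:~R) * (h (Num.floor u + 1) - h (Num.floor u)).

Let polygonalE h (k : int) (u : R) : k%:~R <= u <= (k + 1)%:~R ->
  polygonal h u = h k + (u - k%:~R) * (h (k + 1) - h k).
Proof.
move=> /andP[ku]; rewrite le_eqVlt => /predU1P[->|uk].
  by rewrite /polygonal intrKfloor intrD; ring.
by rewrite /polygonal (@floor_def _ u k) // ku.
Qed.

Let polygonal_continuous h : continuous (polygonal h).
Proof.
have affc (a b c : R) : continuous (fun u : R => a + (u - b) * c).
  move=> u; apply: cvgD; first exact: cvg_cst.
  apply: cvgM; last exact: cvg_cst.
  by apply: cvgB; [exact: cvg_id|exact: cvg_cst].
have seg (k : int) : {within `[k%:~R, (k + 1)%:~R], continuous (polygonal h)}.
  apply: (@subspace_eq_continuous _ _ _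
    (fun u : R => h k + (u - k%:~R) * (h (k + 1) - h k))).
    by move=> u; rewrite inE /= in_itv /= => H; exact: esym (polygonalE h H).
  by apply: continuous_subspaceT => u; exact: affc.
move=> u; pose k := Num.floor u.
have ku : k%:~R <= u := floor_le u.
have uk : u < (k + 1)%:~R by rewrite floorD1_gt.
have k1 : (k - 1)%:~R = k%:~R - 1 :> R by rewrite intrB.
have k2 : (k + 1)%:~R = k%:~R + 1 :> R by rewrite intrD.
have := withinU_continuous (@itv_closed _ _ _ _) (@itv_closed _ _ _ _)
  (seg (k - 1)) (seg k).
rewrite subrK => cU.
apply: (@within_continuous_continuous _ _ _ (k - 1)%:~R (k + 1)%:~R).
- by rewrite k1 k2; lra.
- apply: continuous_subspaceW cU => v /=; rewrite !in_itv/= => /andP[v1 v2].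
  by case: (lerP v k%:~R) => vk; [left; rewrite v1|right; rewrite v2 ltW].
- by rewrite in_itv/= uk andbT k1; lra.
Qed.

Let pt (k : int) : R := s * (o + k%:~R).

Let lattice_pt k : lattice R n (pt k).
Proof. by exists k. Qed.

Let consecutive_pt a b : consecutive (lattice R n) a b <->
  exists k : int, a = pt k /\ b = pt (k + 1).
Proof.
split=> [[[k _ <-] [l _ <-] ab H]|[k [-> ->]]].
  exists k; split=> //; congr (s * (o + _)).
  move: ab; rewrite ltr_pM2l// ltrD2l ltr_int => kl.
  have := H _ (lattice_pt (k + 1)).
  rewrite !ltr_pM2l// !ltrD2l !ltr_int => H1; congr (_%:~R).
  by apply/eqP; rewrite eq_le leNgt; apply/andP; split; [apply/negP => ?; apply: H1|];
    lia.
split=> //; first by rewrite ltr_pM2l// ltrD2l ltr_int; lia.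
move=> _ [l _ <-]; rewrite !ltr_pM2l// !ltrD2l !ltr_int; lia.
Qed.

Definition lattice_interpolant f (t : R) : R :=
  polygonal (fun k => f (pt k)) (t / s - o).

Let interpolantE f (k : int) t : pt k <= t <= pt (k + 1) ->
  lattice_interpolant f t =
  f (pt k) + (t / s - o - k%:~R) * (f (pt (k + 1)) - f (pt k)).
Proof.
move=> kt; apply: polygonalE; rewrite lerBrDl lerBlDl.
by rewrite ler_pdivlMr// ler_pdivrMr// ![_ * s]mulrC.
Qed.

Lemma lattice_interpolantP f :
  linear_interpolation (lattice R n) f (lattice_interpolant f).
Proof.
split=> [t|_ [k _ <-]|a b /consecutive_pt[k [-> ->]]].
- apply: (@continuous_comp _ _ _ (fun t : R => t / s - o)).
    apply: cvgB; last exact: cvg_cst.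
    by apply: cvgM; [exact: cvg_id|exact: cvg_cst].
  exact: polygonal_continuous.
- rewrite (@interpolantE _ k) -/(pt k).
    have -> : pt k / s - o - k%:~R = 0 by rewrite /pt; field; rewrite gt_eqF.
    by rewrite mul0r addr0.
  by rewrite lexx ler_pM2l// lerD2l ler_int; lia.
- exists ((f (pt (k + 1)) - f (pt k)) / s).
  exists (f (pt k) - (o + k%:~R) * (f (pt (k + 1)) - f (pt k))).
  by move=> t /interpolantE ->; ring.
Qed.

Lemma linear_interpolation_unique f g :
  linear_interpolation (lattice R n) f g -> g = lattice_interpolant f.
Proof.
move=> [_ gL gA]; apply/funext => t.
pose k := Num.floor (t / s - o).
have ktk : pt k <= t <= pt (k + 1).
  apply/andP; split; rewrite /pt mulrC.
    by rewrite -ler_pdivlMr// -lerBrDl floor_le.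
  by rewrite -ler_pdivrMr// -lerBlDl ltW// floorD1_gt.
have [m [c gE]] := gA _ _ ((consecutive_pt _ _).2 (ex_intro _ k (conj erefl erefl))).
have kk : pt k <= pt (k + 1) by rewrite ler_pM2l// lerD2l ler_int; lia.
rewrite (interpolantE _ ktk) -!gL// !gE ?lexx ?kk// /pt intrD.
by field; rewrite gt_eqF.
Qed.

End LatticeInterpolation.

(* Main.v *)
Require Import Defs.
From HB Require Import structures.
From mathcomp Require Import all_boot all_order all_algebra.
From mathcomp Require Import all_classical all_reals all_analysis.
From mathcomp Require Import measurable_realfun.
From mathcomp Require Import zify ring lra.
Set Implicit Arguments.
Unset Strict Implicit.
Unset Printing Implicit Defensive.
Import Order.TTheory GRing.Theory Num.Theory.
Import numFieldNormedType.Exports.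
Local Open Scope classical_set_scope.
Local Open Scope ring_scope.

(** The factor 2 comes from a median, and the function Q from a local limit
    estimate; the two are independent of each other.

    Median.  Put p_i = (1 + X_i) / 2, which lies in [0, 1] almost surely, and
    round: given the X_i, let B be the number of successes in independent trials
    of success probabilities p_1, ..., p_n.  As the X_i are independent of mean
    0, B is unconditionally binomial (n, 1/2).  Write (n + x sqrt n) / 2 as
    m + theta with m a natural number and 0 <= theta < 1, and add one more
    trial of success probability 1 - theta.  On the event that
    X_1 + ... + X_n >= x sqrt n, the n + 1 success probabilities add up to at
    least m + 1.  A Poisson-binomial variable of integer mean K is at least K
    with probability at least 1/2 ([half_le_pbtail]); hence, with T(j) the
    probability that a binomial (n, 1/2) variable is at least j,
      P(X_1 + ... + X_n >= x sqrt n) <= 2 ((1 - theta) T(m) + theta T(m + 1))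
    ([sum_tail_le_binomial]).  The point x divides, in the ratio theta to
    1 - theta, the segment between the consecutive lattice points
    (2m - n) / sqrt n and (2m + 2 - n) / sqrt n, so the right-hand side is
    twice the interpolation of the binomial tail at x.

    Domination.  It remains to see that T(j) <= Q((2j - n) / sqrt n) as soon as
    2j >= n ([bintail_le_Qfun]); the only lattice segment that meets the
    half-line x >= 0 and starts to the left of 0 lies in [-1, 1], where
    2 Q >= 1.  The constant C makes Q(1) = 1/2, which settles lattice points in
    (0, 1], where T <= 1/2 by symmetry; and Q(0) >= 1.  At a lattice point
    a = k / sqrt n > 1 three estimates are combined:
    - T(j) is at most j / k = (n + k) / (2k) times the probability of the single
      value j ([bintail_le_mass]);
    - that probability is at most 2 / sqrt n times the normal density at a,
      up to a factor exp(e) where e is about a^2 / (2n) - a^4 / (12n)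
      ([binmass_le]); the constant is the one of the Wallis product;
    - Q(a) is at least the density at a times a / (1 + a^2) + 14 / (9 + a^2),
      by a Mills ratio bound and C >= 14 ([Qfun_ge_tail_ratio]).
    What is left is the inequality
    (1 / a + 1 / sqrt n) exp(e) <= a / (1 + a^2) + 14 / (9 + a^2), which for
    n >= 4 follows from exp(e) <= 1 / (1 - e) and some algebra
    ([correction_le_tail_ratio]); for n = 2 and n = 3 the only lattice point
    beyond 1 at which T is positive is sqrt n, and the values are compared
    directly. *)

(** * Tail probabilities of Poisson-binomial laws *)

Section Pbtail.
Context {R : realFieldType}.
Implicit Types (s t : seq R) (p q : R) (K : nat).

(** The probability that independent trials with success probabilities [s] yield
    at least [K] successes, by conditioning on the first trial. *)
Fixpoint pbtail s K : R :=
  match K, s with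
  | 0, _ => 1
  | _, [::] => 0
  | K'.+1, p :: s' => p * pbtail s' K' + (1 - p) * pbtail s' K
  end.
Arguments pbtail : simpl nomatch.

Lemma pbtail0 s : pbtail s 0 = 1. Proof. by case: s. Qed.

Lemma pbtail_cons p s K :
  pbtail (p :: s) K = p * pbtail s K.-1 + (1 - p) * pbtail s K.
Proof. by case: K => [|K]//; rewrite /= !pbtail0; ring. Qed.

(** With the sum of two success probabilities held fixed, the tail is an affine
    function of their product.  This is what Hoeffding's rearrangement exploits. *)
Lemma pbtail_cons2 p q s K : pbtail [:: p, q & s] K =
  pbtail s K + (p + q) * (pbtail s K.-1 - pbtail s K) +
  p * q * (pbtail s K.-2 - 2 * pbtail s K.-1 + pbtail s K).
Proof. by rewrite !pbtail_cons; ring. Qed.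

Lemma pbtail_perm s t K : perm_eq s t -> pbtail s K = pbtail t K.
Proof.
have rem_head u p L : p \in u -> pbtail u L = pbtail (p :: rem p u) L.
  elim: u L => [//|q u IH] L; rewrite inE /=.
  rewrite (eq_sym p); have [->//|qp /= pu] := eqVneq q p.
  by rewrite pbtail_cons !IH// !pbtail_cons; ring.
elim: s t K => [|p s IH] t K st.
  by move: st; rewrite perm_sym => /perm_nilP ->.
have pt : p \in t by rewrite -(perm_mem st) mem_head.
rewrite (rem_head t p K pt) !pbtail_cons.
have sr : perm_eq s (rem p t).
  by rewrite -(perm_cons p) (perm_trans st)// perm_to_rem.
by rewrite !(IH _ _ sr).
Qed.

Let unit_itv p := 0 <= p <= 1.

Lemma pbtail_ge0 s K : all unit_itv s -> 0 <= pbtail s K.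
Proof.
elim: s K => [|p s IH] [|K]//= /andP[/andP[p0 p1] us].
by rewrite addr_ge0 ?mulr_ge0 ?subr_ge0 ?IH.
Qed.

Lemma pbtail_le1 s K : all unit_itv s -> pbtail s K <= 1.
Proof.
elim: s K => [|p s IH] [|K]//= /andP[/andP[p0 p1] us].
have := IH K us; have := IH K.+1 us; nra.
Qed.

Lemma pbtail_decr s K : all unit_itv s -> pbtail s K <= pbtail s K.-1.
Proof.
elim: s K => [|p s IH] [|[|K]]//.
  by move=> us; rewrite [leRHS]pbtail0 pbtail_le1.
move=> /andP[/andP[p0 p1] us]; rewrite !pbtail_cons.
have := IH K.+1 us; have := IH K.+2 us; rewrite /=; nra.
Qed.

(** The tail increases with each success probability; scaling is the only case
    needed to bring a mean down to an integer. *)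
Lemma pbtail_scale (c : R) s K : 0 <= c <= 1 -> all unit_itv s ->
  pbtail [seq c * p | p <- s] K <= pbtail s K.
Proof.
move=> /andP[c0 c1]; elim: s K => [//|p s IH] K /= /andP[/andP[p0 p1] us].
rewrite !pbtail_cons.
have h1 := IH K us; have h2 := IH K.-1 us; have h3 := pbtail_decr K us.
apply: (@le_trans _ _ (c * p * pbtail s K.-1 + (1 - c * p) * pbtail s K)).
  by rewrite lerD// ler_wpM2l ?mulr_ge0// subr_ge0 mulr_ile1.
have : 0 <= (1 - c) * p * (pbtail s K.-1 - pbtail s K).
  by rewrite !mulr_ge0 ?subr_ge0.
lra.
Qed.

Definition binmass (p : R) (n i : nat) : R :=
  'C(n, i)%:R * p ^+ i * (1 - p) ^+ (n - i).

Lemma binmass_small p n i : (n < i)%N -> binmass p n i = 0.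
Proof. by move=> ni; rewrite /binmass bin_small// !mul0r. Qed.

Lemma binmassS p n i :
  binmass p n.+1 i.+1 = p * binmass p n i + (1 - p) * binmass p n i.+1.
Proof.
have [ni|] := ltnP n i; first by rewrite !binmass_small// ?mulr0 ?addr0// ltnW.
rewrite leq_eqVlt => /predU1P[->|ni].
  by rewrite [in X in _ + X]binmass_small// /binmass !binn !subnn exprS; ring.
rewrite /binmass binS natrD subSS -[in RHS](subnSK ni) exprS.
by rewrite [in LHS](_ : n - i = (n - i.+1).+1)%N ?exprS; [ring|lia].
Qed.

Lemma binmassS0 p n : binmass p n.+1 0 = (1 - p) * binmass p n 0.
Proof. by rewrite /binmass !bin0 !subn0 exprS; ring. Qed.

Lemma pbtail_nseq p n K :
  pbtail (nseq n p) K = \sum_(K <= i < n.+1) binmass p n i.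
Proof.
elim: n K => [|n IH] [|K].
- by rewrite big_nat1 /binmass bin0 /= !expr0 !mulr1.
- by rewrite big_geq.
- rewrite big_nat_recl// binmassS0 pbtail_cons !IH [_.-1]/=.
  under eq_bigr do rewrite binmassS.
  rewrite big_split /= -!mulr_sumr addrCA -mulrDr -[in RHS]big_nat_recl//.
  by rewrite [X in _ = _ + _ * X]big_nat_recr//= binmass_small// addr0.
- rewrite -[nseq n.+1 p]/(p :: nseq n p) pbtail_cons !IH [_.-1]/= [RHS]big_add1.
  under [RHS]eq_bigr do rewrite binmassS.
  rewrite big_split /= -!mulr_sumr; congr (_ + _ * _).
  have [nK|Kn] := ltnP n K; first by rewrite !big_geq// leqW.
  rewrite -(big_add1 _ _ K n.+2 xpredT (binmass p n)).
  by rewrite [RHS]big_nat_recr//= binmass_small// addr0.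
Qed.

(** If [u - v] changes sign at most once, from plus to minus at [i0], then
    [(i - i0) * (u i - v i) <= 0] for all [i]; summing, and using the moment
    condition, [\sum v <= i0 * (\sum u - \sum v)], which forces the conclusion. *)
Lemma single_crossing_sum_le (n : nat) (u v : nat -> R) :
    (forall i, 0 <= u i) -> (forall i, 0 <= v i) ->
    (forall i j, (i < j)%N -> u i < v i -> u j <= v j) ->
    \sum_(0 <= i < n) i%:R * u i = \sum_(0 <= i < n) i.+1%:R * v i ->
  \sum_(0 <= i < n) v i <= \sum_(0 <= i < n) u i.
Proof.
move=> u0 v0 cross mom; rewrite leNgt; apply/negP => uv.
have [/hasP[k _ ukv]|/hasPn nouv] := boolP (has (fun i => u i < v i) (iota 0 n));
    last first.
  move: uv; apply/negP; rewrite -leNgt; apply: ler_sum_nat => i ni.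
  by have := nouv i; rewrite mem_iota -leNgt; apply.
have ex : exists i, u i < v i by exists k.
pose i0 := ex_minn ex.
have [ui0 i0min] : u i0 < v i0 /\ forall i, (i < i0)%N -> v i <= u i.
  rewrite /i0; case: ex_minnP => m um mmin; split => // i im.
  by rewrite leNgt; apply: contraTN im => /mmin; rewrite -leqNgt.
have : \sum_(0 <= i < n) (i%:R - i0%:R) * (u i - v i) <= 0.
  rewrite big_nat; apply: sumr_le0 => i _; have [ii0|i0i] := ltnP i i0.
    by rewrite mulr_le0_ge0 ?subr_ge0 ?i0min// subr_le0 ler_nat ltnW.
  rewrite mulr_ge0_le0 ?subr_ge0 ?ler_nat// subr_le0.
  move: i0i; rewrite leq_eqVlt => /predU1P[<-|i0i]; first exact: ltW.
  exact: cross i0i ui0.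
have -> : \sum_(0 <= i < n) (i%:R - i0%:R) * (u i - v i) =
    \sum_(0 <= i < n) i%:R * u i - \sum_(0 <= i < n) i.+1%:R * v i +
    \sum_(0 <= i < n) v i -
    i0%:R * (\sum_(0 <= i < n) u i - \sum_(0 <= i < n) v i).
  rewrite mulrBr !mulr_sumr -!sumrB -big_split/= -sumrB.
  by apply: eq_bigr => i _; rewrite -natr1; ring.
rewrite mom subrr add0r.
have := ler0n R i0.
have : 0 <= \sum_(0 <= i < n) u i by rewrite sumr_ge0.
move: uv; set U := \sum_(_ <= _ < _) _; set V := \sum_(_ <= _ < _) _.
nra.
Qed.

(* Both directions of the crossing argument below propagate an inequality
   through a pair of multiplicative recurrences. *)
Let step_le (v v' u u' a b c d : R) : 0 <= b -> 0 <= d -> 0 <= u' -> v <= u ->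
  v' * a = v * b -> u' * c = u * d -> c * b <= a * d -> 0 < a * d -> v' <= u'.
Proof.
move=> b0 d0 u'0 vu va uc cb ad; rewrite -(ler_pM2r ad).
have -> : v' * (a * d) = v * (b * d) by rewrite mulrA va; ring.
apply: (@le_trans _ _ (u * (b * d))); first by rewrite ler_wpM2r ?mulr_ge0.
have -> : u * (b * d) = u' * (c * b) by rewrite [RHS]mulrA uc; ring.
exact: ler_wpM2l.
Qed.

(** A binomial variable of integer mean [K] is at least [K] with probability at
    least 1/2.  Compare the masses [u i] at [K + i] and [v i] at [K - 1 - i]:
    their ratio starts above 1, and its successive quotients are at least 1 as
    long as [i ^ 2 * (K ^ 2 - M ^ 2) <= (2 * M + 1) * K ^ 2] with [M = N - K], and
    less than 1 afterwards.  So [u - v] changes sign at most once, and the mean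
    being [K] gives the moment condition of [single_crossing_sum_le]. *)
Lemma half_le_pbtail_binomial N K : (K <= N)%N ->
  2^-1 <= pbtail (nseq N (K%:R / N%:R)) K.
Proof.
case: K => [|K'] KN; first by rewrite pbtail0; lra.
set K := K'.+1 in KN *.
pose M := (N - K)%N; set p : R := K%:R / N%:R; pose b := binmass p N.
have N0 : N%:R != 0 :> R by rewrite pnatr_eq0 -lt0n (leq_trans _ KN).
have pq : p * M%:R = (1 - p) * K%:R by rewrite /p /M natrB//; field.
have p0 : 0 <= p by rewrite divr_ge0.
have p1 : p <= 1 by rewrite ler_pdivrMr ?mul1r ?ler_nat// lt0r N0/=.
have b_ge0 j : 0 <= b j by rewrite !mulr_ge0 ?exprn_ge0 ?subr_ge0.
have b_rec j : b j.+1 * (j.+1 * M)%:R = b j * ((N - j) * K)%:R.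
  have [jN|Nj] := ltnP j N; last first.
    by rewrite /b binmass_small// (eqP Nj) !mul0n mul0r mulr0.
  rewrite /b /binmass -(subnSK jN) !exprS.
  have := congr1 (fun k => k%:R : R) (mul_bin_left N j); rewrite /= !natrM.
  rewrite -(subnSK jN) => binE.
  transitivity ((j.+1%:R * 'C(N, j.+1)%:R) * p ^+ j * (1 - p) ^+ (N - j.+1) *
    (p * M%:R)); first by ring.
  by rewrite binE pq; ring.
have sum_b : \sum_(0 <= j < N.+1) b j = 1.
  by rewrite -pbtail_nseq pbtail0.
have mean_b : \sum_(0 <= j < N.+1) (j%:R - K%:R) * b j = 0.
  have shift : \sum_(0 <= j < N.+1) j%:R * b j * M%:R =
      \sum_(0 <= j < N.+1) (N%:R - j%:R) * b j * K%:R.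
    rewrite big_nat_recl// !mul0r add0r [RHS]big_nat_recr//= subrr !mul0r addr0.
    apply: eq_big_nat => j /andP[_ jN]; rewrite -natrB; last exact: ltnW.
    by have := b_rec j; rewrite !natrM => h; rewrite mulrAC mulrC h; ring.
  apply: (mulfI N0); rewrite mulr0 mulr_sumr.
  transitivity (\sum_(0 <= j < N.+1) j%:R * b j * M%:R -
    \sum_(0 <= j < N.+1) (N%:R - j%:R) * b j * K%:R); last by rewrite shift subrr.
  by rewrite -sumrB; apply: eq_bigr => j _; rewrite /M natrB//; ring.
pose u i := b (K + i)%N; pose v i := if (i < K)%N then b (K - i.+1)%N else 0.
have sum0 m n (F : nat -> R) : (forall i, (m <= i < n)%N -> F i = 0) ->
    \sum_(m <= i < n) F i = 0.
  by move=> F0; rewrite big_nat big1.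
have split_sum (g : nat -> R) : \sum_(0 <= j < N.+1) g j * b j =
    \sum_(0 <= i < N.+1) g (K + i)%N * u i +
    \sum_(0 <= i < N.+1) g (K - i.+1)%N * v i.
  rewrite (@big_cat_nat _ _ _ K)//=; last exact: leqW.
  rewrite addrC; congr (_ + _).
    rewrite -[X in \sum_(X <= _ < _) _]add0n big_addn.
    rewrite [RHS](@big_cat_nat _ _ _ (N.+1 - K))//= ?leq_subr//.
    rewrite [X in _ = _ + X]sum0 ?addr0 => [|i /andP[Ni _]].
      by apply: eq_bigr => i _; rewrite /u addnC.
    by rewrite /u /b binmass_small ?mulr0//; lia.
  rewrite big_nat_rev /= add0n [RHS](@big_cat_nat _ _ _ K)//=; last exact: leqW.
  rewrite [X in _ = _ + X]sum0 ?addr0 => [|i /andP[Ki _]].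
    by apply: eq_big_nat => i /andP[_ iK]; rewrite /v iK.
  by rewrite /v ltnNge Ki mulr0.
have u0 i : 0 <= u i by exact: b_ge0.
have v0 i : 0 <= v i by rewrite /v; case: ifP.
suff : \sum_(0 <= i < N.+1) v i <= \sum_(0 <= i < N.+1) u i.
  have -> : pbtail (nseq N p) K = \sum_(0 <= i < N.+1) u i.
    rewrite pbtail_nseq -[X in \sum_(X <= _ < _) _]add0n big_addn.
    rewrite [RHS](@big_cat_nat _ _ _ (N.+1 - K))//= ?leq_subr//.
    rewrite [X in _ = _ + X]sum0 ?addr0 => [|i /andP[Ni _]].
      by apply: eq_bigr => i _; rewrite /u addnC.
    by rewrite /u /b binmass_small//; lia.
  have := split_sum (fun=> 1); under eq_bigr do rewrite mul1r.
  rewrite sum_b; under eq_bigr do rewrite mul1r.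
  under [X in _ + X]eq_bigr do rewrite mul1r.
  lra.
apply: single_crossing_sum_le => //; last first.
  have := split_sum (fun j => j%:R - K%:R); rewrite mean_b => /esym/eqP.
  rewrite addr_eq0 => /eqP.
  under eq_bigr do rewrite natrD (addrC K%:R) addrK.
  move=> ->; rewrite -sumrN; apply: eq_bigr => i _; rewrite /v.
  case: ifP => iK; last by rewrite !mulr0 oppr0.
  by rewrite natrB//; ring.
have u_rec i : u i.+1 * ((K + i.+1) * M)%:R = u i * ((M - i) * K)%:R.
  by have := b_rec (K + i)%N; rewrite subnDA /u addnS.
have v_rec i : v i.+1 * ((M + i.+2) * K)%:R = v i * ((K - i.+1) * M)%:R.
  rewrite /v; have [iK|] := ltnP i.+1 K; last first.
    by rewrite mul0r -subn_eq0 => /eqP ->; rewrite mul0n mulr0.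
  rewrite (ltnW iK); have := b_rec (K - i.+2)%N.
  rewrite (_ : (K - i.+2).+1 = K - i.+1)%N; last lia.
  by rewrite (_ : N - (K - i.+2) = M + i.+2)%N//; lia.
have [M0|M_gt0] := posnP M.
  move=> i j ij; suff -> : v i = 0 by rewrite ltNge u0.
  rewrite /v; case: ifP => // iK; have := b_rec (K - i.+1)%N.
  rewrite M0 muln0 mulr0 => /esym/eqP; rewrite mulf_eq0 pnatr_eq0 => /orP[/eqP//|].
  by rewrite muln_eq0; lia.
have M_ge1 : 1 <= M%:R :> R by rewrite (ler_nat R 1).
have K_ge1 : 1 <= K%:R :> R by rewrite (ler_nat R 1).
(* D i: the quotient of successive ratios has dropped below 1 at index i *)
pose D (i : nat) := (2 * M%:R + 1) * K%:R ^+ 2 < i%:R ^+ 2 * (K%:R ^+ 2 - M%:R ^+ 2) :> R.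
have D_gt i : D i -> M%:R < K%:R :> R.
  rewrite /D !ltNge; apply: contraNN => KM.
  by apply: (@le_trans _ _ 0); [rewrite mulr_ge0_le0 ?sqr_ge0// |]; nra.
have D_mono i j : (i <= j)%N -> D i -> D j.
  rewrite /D => ij Di; apply: (lt_le_trans Di).
  have KM : 0 < K%:R ^+ 2 - M%:R ^+ 2 :> R by have := D_gt _ Di; nra.
  by rewrite ler_pM2r// lerXn2r ?nnegrE ?ler0n// ler_nat.
have rec_real i : (i < K)%N -> (i <= M)%N ->
   u i.+1 * ((K%:R + i.+1%:R) * M%:R) = u i * ((M%:R - i%:R) * K%:R) /\
   v i.+1 * ((M%:R + i.+2%:R) * K%:R) = v i * ((K%:R - i.+1%:R) * M%:R).
  move=> iK iM; have := u_rec i; have := v_rec i.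
  by rewrite !natrM !natrD !natrB.
have below i : ~~ D i -> v i <= u i.
  elim: i => [_|i IH ND].
    have := b_rec K'; rewrite /u /v addn0 subSS subn0 !natrM.
    rewrite (_ : N - K' = M.+1)%N; last by rewrite /M /K subnSK.
    rewrite -/K -[M.+1%:R]natr1 => bK.
    have c0 : 0 < (M%:R + 1) * K%:R :> R by rewrite mulr_gt0//; lra.
    by rewrite -(ler_pM2r c0) -bK ler_wpM2l// mulrC ler_wpM2r//; lra.
  have [Ki|iK] := leqP K i.+1; first by rewrite /v ltnNge Ki.
  have /IH vu : ~~ D i by apply: contraNN ND; apply: D_mono.
  have iM : (i < M)%N.
    move: ND; rewrite /D -leNgt ltnNge; apply: contraL => Mi; rewrite -ltNge.
    have : i.+1%:R < K%:R :> R by rewrite ltr_nat.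
    have : M%:R <= i%:R :> R by rewrite ler_nat.
    move: M_ge1; rewrite -natr1.
    set m := M%:R; set k := K%:R; set x := i%:R => m1 mx xk.
    apply: (@lt_le_trans _ _ ((m + 1) ^+ 2 * (k ^+ 2 - m ^+ 2))).
      have : 0 < m ^+ 2 * ((k - m - 1) * (k + m + 1)).
        by rewrite !mulr_gt0 ?exprn_gt0//; lra.
      lra.
    by rewrite ler_wpM2r ?subr_ge0 ?lerXn2r ?nnegrE//; nra.
  have [] := rec_real i (ltnW iK) (ltnW iM).
  have iK' : i.+1%:R < K%:R :> R by rewrite ltr_nat.
  have iM' : i.+1%:R <= M%:R :> R by rewrite ler_nat.
  move: ND; rewrite /D -leNgt => ND uE vE.
  apply: (step_le _ _ _ vu vE uE) => //.
  - by rewrite mulr_ge0// subr_ge0 ltW.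
  - by rewrite mulr_ge0// subr_ge0 (le_trans _ iM')// ler_nat.
  - move: ND; rewrite -!natr1; lra.
  - have : 0 < M%:R - i%:R :> R by rewrite subr_gt0 ltr_nat.
    by have := ler0n R i.+2 => ? ?; rewrite !mulr_gt0 ?subr_gt0//; lra.
have above i j : (i <= j)%N -> D i -> u i <= v i -> u j <= v j.
  elim: j => [|j IH]; first by rewrite leqn0 => /eqP ->.
  rewrite leq_eqVlt => /predU1P[-> //|ij Di uvi].
  have [Mj|jM] := leqP M j.
    have := u_rec j; rewrite (eqP Mj) mul0n mulr0 => /eqP.
    rewrite mulf_eq0 pnatr_eq0 => /orP[/eqP-> //|]; lia.
  have KM : (M < K)%N by rewrite -(ltr_nat R); exact: D_gt Di.
  have [] := rec_real j (ltn_trans jM KM) (ltnW jM).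
  have := IH ij Di uvi; have : D j.+1 by apply: D_mono Di; exact: leqW.
  have jM' : j.+1%:R <= M%:R :> R by rewrite ler_nat.
  have jK' : j.+1%:R < K%:R :> R by rewrite ltr_nat (leq_trans _ KM).
  rewrite /D => Dj uvj uE vE.
  apply: (step_le _ _ _ uvj uE vE) => //.
  - by rewrite mulr_ge0// subr_ge0 (le_trans _ jM')// ler_nat.
  - by rewrite mulr_ge0// subr_ge0 ltW.
  - move: Dj; rewrite -!natr1; lra.
  - have : 0 < K%:R - j.+1%:R :> R by rewrite subr_gt0.
    by have := ler0n R j.+1 => ? ?; rewrite !mulr_gt0 ?subr_gt0//; lra.
move=> i j /ltnW ij uv; apply: (above i) => //; last exact: ltW.
by apply: contraLR uv => /below; rewrite -leNgt.
Qed.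

Lemma sum_le_size s : all unit_itv s -> \sum_(p <- s) p <= (size s)%:R.
Proof.
elim: s => [|p s IH]; first by rewrite big_nil.
by move=> /= /andP[/andP[_ p1] /IH]; rewrite big_cons -natr1; lra.
Qed.

Lemma straddle_mean s (m : R) : \sum_(p <- s) p = (size s)%:R * m ->
  ~~ all (pred1 m) s ->
  exists p q t, [/\ p < m, m < q & perm_eq s [:: p, q & t]].
Proof.
move=> sm nsm.
have sum0 : \sum_(p <- s) (p - m) = 0.
  by rewrite sumrB sm big_const_seq count_predT iter_addr_0 mulr_natl subrr.
have one_sided (f : R -> R) : (forall p, f p == 0 -> p == m) ->
    \sum_(p <- s) f p = 0 -> has (fun p => f p < 0) s.
  move=> fm f0; apply: contraNT nsm; rewrite -all_predC => ge.
  have {}ge : all (fun p => 0 <= f p) s.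
    by apply: sub_all ge => p /=; rewrite -leNgt.
  have : \sum_(p <- s) f p == 0 by rewrite f0.
  rewrite -{1}(all_filterP ge) big_filter psumr_eq0// => /allP h.
  by apply/allP => p ps; rewrite /= fm// (implyP (h _ ps))// (allP ge).
have /hasP[p ps pm] : has (fun p => p - m < 0) s.
  by apply: one_sided => // p; rewrite subr_eq0.
have /hasP[q qs mq] : has (fun p => m - p < 0) s.
  apply: one_sided => [p'|]; first by rewrite subr_eq0 eq_sym.
  by apply: oppr_inj; rewrite oppr0 -sumrN -[RHS]sum0; apply: eq_bigr => p' _; ring.
rewrite !subr_lt0 in pm mq.
exists p, q, (rem q (rem p s)); split => //.
rewrite (perm_trans (perm_to_rem ps))// perm_cons perm_to_rem//.
by move: qs; rewrite (perm_mem (perm_to_rem ps)) inE gt_eqF// (lt_trans pm).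
Qed.

(** Hoeffding's argument.  If the success probabilities are not all equal to
    their mean [m], take [p < m < q] among them.  The tail is affine in [p * q]
    when [p + q] is fixed, so it does not increase in one of two moves: lowering
    the product until one of the two becomes 0 or 1 and can be dropped, or
    raising it until one of the two becomes [m].  The first move shortens the
    list, the second reduces the number of entries different from the mean,
    so that only the binomial case remains. *)
Lemma half_le_pbtail_eq s K : all unit_itv s -> \sum_(p <- s) p = K%:R ->
  2^-1 <= pbtail s K.
Proof.
have [n] := ubnP (size s); elim: n s K => // n IHn s K; rewrite ltnS => sn us sK.
have Ks : (K <= size s)%N by rewrite -(ler_nat R) -sK sum_le_size.
pose m : R := K%:R / (size s)%:R.
have sm : (size s)%:R * m = K%:R.
  rewrite /m mulrC; have [s0|s0] := posnP (size s); last first.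
    by rewrite divfK// pnatr_eq0 -lt0n.
  by move: Ks; rewrite s0 leqn0 => /eqP ->; rewrite !mul0r.
(* inner induction: the number of entries that differ from the mean *)
have [c] := ubnP (count (predC (pred1 m)) s).
move: {-2}s (erefl (size s)) us sK; elim: c => // c IHc t ts ut tK; rewrite ltnS => ct.
have [/all_pred1P ->|] := boolP (all (pred1 m) t).
  by rewrite ts; exact: half_le_pbtail_binomial.
case/straddle_mean => [|p [q [r [pm mq tr]]]]; first by rewrite ts sm.
rewrite (pbtail_perm K tr).
have := ut; rewrite (perm_all _ tr) /= => /and3P[/andP[p0 p1] /andP[q0 q1] ur].
have := tK; rewrite (perm_big _ tr) !big_cons /= => rK.
have tS : size t = (size r).+2 by rewrite (perm_size tr).
have rn : ((size r).+1 < n)%N by rewrite -tS ts.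
set e := pbtail r K.-2 - 2 * pbtail r K.-1 + pbtail r K.
have move_pq p' q' : p' + q' = p + q -> p' * q' * e <= p * q * e ->
    pbtail [:: p', q' & r] K <= pbtail [:: p, q & r] K.
  by move=> pq epq; rewrite !pbtail_cons2 pq lerD2l.
have [e_ge0|e_lt0] := leP 0 e; last first.
  apply: (le_trans _ (move_pq m (p + q - m) _ _)).
  - apply: IHc; rewrite /= ?ts ?tS//.
    + by rewrite -tS.
    + by rewrite ur andbT /unit_itv; lra.
    + by rewrite !big_cons; lra.
    + apply: leq_trans ct; rewrite (permP tr) /= eqxx (lt_eqF pm) (gt_eqF mq) /=.
      by case: (_ == _).
  - by ring.
  - rewrite ler_nM2r// -subr_ge0.
    have : 0 <= (m - p) * (q - m) by rewrite mulr_ge0 ?subr_ge0 ?ltW.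
    by lra.
have [pq1|pq1] := leP (p + q) 1.
  apply: (le_trans _ (move_pq 0 (p + q) _ _)).
  - rewrite pbtail_cons mul0r subr0 mul1r add0r; apply: IHn => //=.
      by rewrite ur andbT /unit_itv addr_ge0.
    by rewrite big_cons; lra.
  - by ring.
  - by rewrite ler_wpM2r// mul0r mulr_ge0.
have r0 : 0 <= \sum_(x <- r) x.
  by rewrite big_seq sumr_ge0// => x /(allP ur) /andP[].
have K_gt0 : (0 < K)%N by rewrite -(ltr_nat R) -rK; lra.
apply: (le_trans _ (move_pq 1 (p + q - 1) _ _)).
- rewrite pbtail_cons mul1r subrr mul0r addr0; apply: IHn => //=.
    by rewrite ur andbT /unit_itv; lra.
  by move: rK; rewrite big_cons -subn1 natrB//; lra.
- by ring.
- rewrite ler_wpM2r// -subr_ge0; have : 0 <= (1 - p) * (1 - q) by rewrite mulr_ge0 ?subr_ge0.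
  by lra.
Qed.

Lemma half_le_pbtail s K : all unit_itv s -> K%:R <= \sum_(p <- s) p ->
  2^-1 <= pbtail s K.
Proof.
case: K => [|K]; first by rewrite pbtail0; lra.
move=> us Ks; have s0 : 0 < \sum_(p <- s) p by rewrite (lt_le_trans _ Ks)// ltr0n.
pose c := K.+1%:R / \sum_(p <- s) p.
have c01 : 0 <= c <= 1 by rewrite /c ler_pdivrMr// mul1r Ks divr_ge0// ltW.
apply: le_trans (pbtail_scale K.+1 c01 us); apply: half_le_pbtail_eq.
  rewrite all_map; apply: sub_all us => p /andP[p0 p1] /=; case/andP: c01 => c0 c1.
  by rewrite /unit_itv mulr_ge0//= mulr_ile1.
by rewrite big_map -mulr_sumr /c divfK// gt_eqF.
Qed.

End Pbtail.
Arguments pbtail {R} s K : simpl nomatch.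

(** * An elementary inequality behind the Gaussian comparison *)

Section TailRatio.
Context {R : realFieldType}.
Implicit Types (a h e : R).

(** A lower bound for [Qfun a] divided by the normal density at [a]. *)
Definition tail_ratio a : R := a / (1 + a ^+ 2) + 14 / (9 + a ^+ 2).

Let num a : R := a * (9 + a ^+ 2) + 14 * (1 + a ^+ 2).
Let den a : R := (1 + a ^+ 2) * (9 + a ^+ 2).

Let den_gt0 a : 0 < den a.
Proof. by rewrite /den; nra. Qed.

Let tail_ratioE a : tail_ratio a = num a / den a.
Proof.
have : 1 + a ^+ 2 != 0 by rewrite gt_eqF//; nra.
have : 9 + a ^+ 2 != 0 by rewrite gt_eqF//; nra.
by move=> a9 a1; rewrite /tail_ratio /num /den; field; rewrite a9.
Qed.

Let le_tail_ratio c d a : 0 < a ->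
  c * den a <= d * (a * num a) -> c / a <= d * tail_ratio a.
Proof.
move=> a0 cd; rewrite tail_ratioE ler_pdivrMr// mulrAC mulrA ler_pdivlMr//.
by apply: le_trans cd _; rewrite le_eqVlt; apply/orP; left; apply/eqP; ring.
Qed.

Lemma invr_le_tail_ratio a : 1 <= a -> a^-1 <= tail_ratio a.
Proof.
move=> a1; rewrite -div1r -[leRHS]mul1r le_tail_ratio ?(lt_le_trans _ a1)//.
rewrite /num /den !mul1r -subr_ge0.
have -> : a * (a * (9 + a ^+ 2) + 14 * (1 + a ^+ 2)) - (1 + a ^+ 2) * (9 + a ^+ 2)
  = 14 * a ^+ 3 + 14 * a - 9 - a ^+ 2 by ring.
nra.
Qed.

(* In h the two sides differ by a concave function, so that it is enough to
   compare at h = 0 and at the right end hm. *)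
Let small_range a h hm e : 0 < a -> 0 < hm -> 0 <= h <= hm -> 0 <= e ->
  a^-1 <= tail_ratio a -> a^-1 + hm <= (1 - e * hm ^+ 2) * tail_ratio a ->
  a^-1 + h <= (1 - e * h ^+ 2) * tail_ratio a.
Proof.
move=> a0 hm0 /andP[h0 hhm] e0 f0 fm.
pose t := h / hm; have t0 : 0 <= t by rewrite divr_ge0// ltW.
have t1 : t <= 1 by rewrite ler_pdivrMr ?mul1r.
have hE : h = t * hm by rewrite divfK// gt_eqF.
have r0 : 0 <= tail_ratio a by rewrite (le_trans _ f0)// invr_ge0 ltW.
rewrite hE; set r := tail_ratio a in f0 fm r0 *.
have X0 : 0 <= e * hm ^+ 2 * r by rewrite mulr_ge0// mulr_ge0// sqr_ge0.
have -> : (1 - e * (t * hm) ^+ 2) * r = r - t ^+ 2 * (e * hm ^+ 2 * r) by ring.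
have fm' : a^-1 + hm <= r - e * hm ^+ 2 * r by lra.
have tt : 0 <= (t - t ^+ 2) * (e * hm ^+ 2 * r).
  by rewrite mulr_ge0// subr_ge0 expr2 ler_piMl.
have := mulr_ge0 t0 (eqbRL (subr_ge0 _ _) fm').
have : 0 <= (1 - t) * (r - a^-1) by rewrite mulr_ge0 ?subr_ge0.
lra.
Qed.

(** Here [h] stands for [1 / sqrt n] and [e] for the exponent of the correction
    to the local limit theorem; [e] is positive for moderate [a] and very negative
    for [a] larger than the fourth root of [n].  While [a ^+ 2 <= 10] the loss
    is absorbed by the gap between the two sides.  Beyond that, the two sides
    compare without using [e] when [a <= 12], because [2 / a <= tail_ratio a];
    for [a > 12] the gap is at least [10 / a ^+ 2], and the arithmetic-geometric
    mean inequality shows that [h] is at most this gap plus the gain. *)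
Lemma correction_le_tail_ratio a h e : 1 <= a -> 0 <= h <= 2^-1 -> a * h <= 1 ->
  (a ^+ 2 <= 10 -> e <= 4 / 75 * a ^+ 2 * (10 - a ^+ 2) * h ^+ 2) ->
  (10 <= a ^+ 2 -> e <= 16 / 375 * a ^+ 2 * (10 - a ^+ 2) * h ^+ 2) ->
  a^-1 + h <= (1 - e) * tail_ratio a.
Proof.
move=> a1 /andP[h0 h2] ah e_small e_big.
have a0 : 0 < a by lra.
have ia : a^-1 * a = 1 by rewrite mulVf// gt_eqF.
have inv_le := invr_le_tail_ratio a1.
have r0 : 0 <= tail_ratio a by rewrite (le_trans _ inv_le)// invr_ge0 ltW.
have h_le : h <= a^-1 by rewrite -[leRHS]mul1r ler_pdivlMr// mulrC.
have [a10|a10] := leP (a ^+ 2) 10.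
  set e' := 4 / 75 * a ^+ 2 * (10 - a ^+ 2) in e_small.
  have e'0 : 0 <= e'.
    by apply: mulr_ge0; [apply: mulr_ge0; [lra|exact: sqr_ge0]|rewrite subr_ge0].
  apply: (@le_trans _ _ ((1 - e' * h ^+ 2) * tail_ratio a)); last first.
    by rewrite ler_wpM2r// lerD2l lerN2 e_small.
  have [a2|a2] := leP a 2.
    apply: (@small_range _ _ 2^-1) => //; rewrite ?invr_gt0 ?h0//.
    have -> : a^-1 + 2^-1 = (1 + a / 2) / a by field; rewrite gt_eqF.
    rewrite le_tail_ratio// -subr_ge0 /e' /num /den.
    (* a polynomial of degree 8 with positive Bernstein coefficients on [1, 2] *)
    have P i j : 0 <= (a - 1) ^+ i * (2 - a) ^+ j.
      by rewrite mulr_ge0// exprn_ge0// subr_ge0.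
    have := (P 0 8, P 1 7, P 2 6, P 3 5, P 4 4, P 5 3, P 6 2, P 7 1, P 8 0)%N.
    move=> [[[[[[[[? ?] ?] ?] ?] ?] ?] ?] ?].
    lra.
  apply: (@small_range _ _ a^-1) => //; rewrite ?invr_gt0 ?h0//.
  have -> : a^-1 + a^-1 = 2 / a by field; rewrite gt_eqF.
  rewrite le_tail_ratio//.
  have -> : e' * a^-1 ^+ 2 = 4 / 75 * (10 - a ^+ 2) by rewrite /e'; field; rewrite gt_eqF.
  rewrite -subr_ge0 /num /den.
  (* the expansion at 2 has nonnegative coefficients *)
  have P i : 0 <= (a - 2) ^+ i by rewrite exprn_ge0// subr_ge0 ltW.
  have := (P 1, P 2, P 3, P 4, P 5, P 6)%N => -[[[[[? ?] ?] ?] ?] ?].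
  lra.
have a3 : 3 <= a by nra.
set g := 16 / 375 * a ^+ 2 * (a ^+ 2 - 10).
have g0 : 0 <= g.
  by apply: mulr_ge0; [apply: mulr_ge0; [lra|exact: sqr_ge0]|rewrite subr_ge0 ltW].
apply: (@le_trans _ _ ((1 + g * h ^+ 2) * tail_ratio a)); last first.
  rewrite ler_wpM2r// lerD2l lerNr; apply: le_trans (e_big (ltW a10)) _.
  by rewrite /g; lra.
have [a12|a12] := leP a 12.
  apply: (@le_trans _ _ (2 / a)); first by move: h_le; lra.
  apply: (@le_trans _ _ (1 * tail_ratio a)).
    rewrite le_tail_ratio// -subr_ge0 /num /den.
    have : 0 <= a ^+ 2 * ((a - 3) * (12 - a)).
      by rewrite mulr_ge0 ?sqr_ge0// mulr_ge0 ?subr_ge0.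
    have : 0 <= a ^+ 3 by rewrite exprn_ge0 // ltW.
    nra.
  by rewrite ler_wpM2r// lerDl mulr_ge0 ?sqr_ge0.
have inv10 : a^-1 + 10 / a ^+ 2 <= tail_ratio a.
  have -> : a^-1 + 10 / a ^+ 2 = (1 + 10 / a) / a by field; rewrite gt_eqF.
  rewrite -[leRHS]mul1r le_tail_ratio// -subr_ge0 /num /den.
  have -> : 1 * (a * (a * (9 + a ^+ 2) + 14 * (1 + a ^+ 2))) -
     (1 + 10 / a) * ((1 + a ^+ 2) * (9 + a ^+ 2)) =
     (4 * a ^+ 4 - a ^+ 3 - 86 * a ^+ 2 - 9 * a - 90) / a.
    by field; rewrite gt_eqF.
  rewrite divr_ge0 ?(ltW a0)//.
  have P i : 0 <= (a - 12) ^+ i by rewrite exprn_ge0// subr_ge0 ltW.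
  have := (P 1, P 2, P 3, P 4)%N => -[[[? ?] ?] ?]; lra.
have : h <= 10 / a ^+ 2 + g * h ^+ 2 * a^-1.
  rewrite -(ler_pM2r (exprn_gt0 2 a0)).
  have -> : (10 / a ^+ 2 + g * h ^+ 2 / a) * a ^+ 2 = 10 + g * h ^+ 2 * a.
    by field; rewrite gt_eqF.
  have gl : a ^+ 4 / 30 <= g.
    have : 0 <= a ^+ 2 * ((a - 12) * (a + 12)).
      by rewrite mulr_ge0 ?sqr_ge0// mulr_ge0//; lra.
    have := sqr_ge0 a; rewrite /g; lra.
  have : a ^+ 4 / 30 * (h ^+ 2 * a) <= g * (h ^+ 2 * a).
    by rewrite ler_wpM2r// mulr_ge0 ?sqr_ge0// ltW.
  set u := h * a ^+ 2.
  have -> : a ^+ 4 / 30 * (h ^+ 2 * a) = u ^+ 2 * a / 30 by rewrite /u; ring.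
  have : u ^+ 2 * 12 <= u ^+ 2 * a by rewrite ler_wpM2l ?sqr_ge0// ltW.
  have := sqr_ge0 (u - 5); have := sqr_ge0 u; lra.
have : g * h ^+ 2 * a^-1 <= g * h ^+ 2 * tail_ratio a.
  by rewrite ler_wpM2l// mulr_ge0 ?sqr_ge0.
lra.
Qed.

End TailRatio.

(** * Elementary calculus and the Wallis inequality *)

Section Calculus.
Context {R : realType}.
Implicit Types (f : R -> R) (a b x t : R) (n m : nat).

Lemma le_of_derive_ge0 f f' a b : a <= b ->
  (forall x, a <= x <= b -> is_derive x 1 f (f' x)) ->
  (forall x, a < x < b -> 0 <= f' x) -> f a <= f b.
Proof.
move=> ab df f'0.
have dfab x : a <= x <= b -> derivable f x 1 by move=> /df [].
apply: (@ger0_derive1_ndecr R f a b) => // [x|x|].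
- by rewrite in_itv/= => /andP[ax xb]; apply: dfab; rewrite !ltW.
- rewrite in_itv/= => axb; rewrite derive1E.
  have [_ ->] : is_derive x 1 f (f' x) by apply: df; case/andP: axb => *; rewrite !ltW.
  exact: f'0.
- by apply: derivable_within_continuous => x; rewrite in_itv/=; exact: dfab.
Qed.

Lemma expR_ge_taylor2 t : 0 <= t -> 1 + t + t ^+ 2 / 2 <= expR t.
Proof.
move=> t0; rewrite -subr_ge0.
pose f t := expR t - (1 + t + t ^+ 2 / 2).
have -> : 0 = f 0 by rewrite /f expR0; ring.
apply: (@le_of_derive_ge0 f (fun x => expR x - (1 + x))) => // x x0.
  by rewrite /f; apply: is_derive_eq; rewrite /GRing.scale/=; field.
  by rewrite /= subr_ge0 expR_ge1Dx.
Qed.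

Lemma is_derive1M f g (x f' g' : R) : is_derive x 1 f f' -> is_derive x 1 g g' ->
  is_derive x 1 (fun t => f t * g t) (f' * g x + f x * g').
Proof.
move=> df dg; apply: (is_derive_eq (is_deriveM df dg)).
by rewrite /GRing.scale/=; ring.
Qed.

Lemma is_derive1X f n (x f' : R) : is_derive x 1 f f' ->
  is_derive x 1 (fun t => f t ^+ n) (n%:R * f x ^+ n.-1 * f').
Proof. by move=> df; rewrite -exprfctE; exact: is_deriveX. Qed.

Lemma is_derive1_expR f (x f' : R) : is_derive x 1 f f' ->
  is_derive x 1 (fun t => expR (f t)) (expR (f x) * f').
Proof. by move=> df; exact: (is_derive1_comp (is_derive_expR (f x)) df). Qed.

Lemma is_derive1V f (x f' : R) : f x != 0 -> is_derive x 1 f f' ->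
  is_derive x 1 (fun t => (f t)^-1) (- f' / f x ^+ 2).
Proof.
move=> fx df; apply: (is_derive_eq (is_deriveV fx df)).
by rewrite /GRing.scale/=; ring.
Qed.

(** The exponent keeps two terms of the series of [ln ((1 - t) / (1 + t))]: the
    cubic term produces the fourth power in [mass_exponent]. *)
Lemma ratio_le_expR t : 0 <= t <= 1 ->
  (1 - t) / (1 + t) <= expR (- (2 * t + 2 / 3 * t ^+ 3)).
Proof.
move=> /andP[t0 t1].
pose q x : R := 2 * x + 2 / 3 * x ^+ 3.
pose f x : R := expR (q x) * ((x - 1) * (1 + x)^-1).
pose f' x : R := expR (q x) * (2 * x ^+ 4 / (1 + x) ^+ 2).
have df x : 0 <= x <= t -> is_derive x 1 f (f' x).
  move=> /andP[x0 x1].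
  have x1' : 1 + x != 0 by rewrite gt_eqF//; lra.
  have dq : is_derive x 1 q (2 + 2 * x ^+ 2).
    by rewrite /q; apply: is_derive_eq; rewrite /GRing.scale/=; field.
  have dn : is_derive x 1 (fun x => x - 1) 1.
    by apply: is_derive_eq; ring.
  have dd : is_derive x 1 (fun x => 1 + x) 1.
    by apply: is_derive_eq; ring.
  apply: (is_derive_eq (is_derive1M (is_derive1_expR dq)
    (is_derive1M dn (is_derive1V x1' dd)))).
  by rewrite /f'; field.
have f'0 x : 0 < x < t -> 0 <= f' x.
  move=> /andP[x0 _].
  by rewrite mulr_ge0 ?expR_ge0// divr_ge0 ?exprn_even_ge0// mulr_ge0 ?exprn_even_ge0.
have := le_of_derive_ge0 t0 df f'0.
rewrite /f /q expr0n /= !(mulr0, addr0, expR0) sub0r invr1 mulr1 mul1r => h.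
rewrite expRN -[leRHS]mul1r ler_pdivlMr ?expR_gt0// mulrC.
by rewrite -opprB mulNr mulrN; lra.
Qed.

(** The primitive of [cos ^ n] that vanishes at 0, from the reduction formula;
    it gives the Wallis integrals without any integration theory. *)
Fixpoint cos_primitive n x : R :=
  match n with
  | 0 => x
  | 1 => sin x
  | n'.+2 => (sin x * cos x ^+ n'.+1 + n'.+1%:R * cos_primitive n' x) / n'.+2%:R
  end.

Lemma is_derive_cos_primitive n x :
  is_derive x 1 (cos_primitive n) (cos x ^+ n).
Proof.
suff : is_derive x 1 (cos_primitive n) (cos x ^+ n) /\
  is_derive x 1 (cos_primitive n.+1) (cos x ^+ n.+1) by case.
elim: n => [|n [IH0 IH1]].
  split; first exact: is_derive_id.
  by rewrite expr1; exact: is_derive_sin.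
split => //.
have dsc : is_derive x 1 (fun x => sin x * cos x ^+ n.+1)
    (cos x * cos x ^+ n.+1 + sin x * (n.+1%:R * cos x ^+ n * - sin x)).
  exact: (is_derive1M (is_derive_sin x) (is_derive1X n.+1 (is_derive_cos x))).
have -> : cos_primitive n.+2 = (n.+2%:R^-1 : R) \*:
    ((fun x => sin x * cos x ^+ n.+1) + n.+1%:R \*: cos_primitive n).
  by apply/funext => y; rewrite /= /GRing.scale/= mulrC.
apply: (is_derive_eq (is_deriveZ _ (is_deriveD dsc (is_deriveZ _ IH0)))).
have n2 : n.+2%:R != 0 :> R by rewrite pnatr_eq0.
rewrite /GRing.scale/=; apply: (mulfI n2); rewrite mulVKf//.
rewrite !exprS !mulrA -[n.+2]addn2 -[n.+1]addn1 !natrD.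
transitivity (cos x ^+ 2 * cos x ^+ n - (n%:R + 1) * cos x ^+ n * sin x ^+ 2 +
  (n%:R + 1) * cos x ^+ n); first by ring.
by rewrite sin2cos2; ring.
Qed.

Lemma cos_primitive0 n : cos_primitive n 0 = 0.
Proof.
suff : cos_primitive n 0 = 0 /\ cos_primitive n.+1 0 = 0 by case.
elim: n => [|n [IH0 IH1]]; first by rewrite /= sin0.
by rewrite /= -/(cos_primitive n.+1 _) IH1 IH0 sin0 mul0r mulr0 addr0 mul0r.
Qed.

Definition wallis n := cos_primitive n (pi / 2).

Lemma wallisSS n : n.+2%:R * wallis n.+2 = n.+1%:R * wallis n.
Proof.
by rewrite /wallis /= cos_pihalf expr0n /= mulr0 add0r mulrC divfK ?pnatr_eq0.
Qed.

Let cos_itv x : 0 < x < pi / 2 -> 0 <= cos x <= 1.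
Proof.
move=> /andP[x0 x1]; rewrite cos_le1 cos_ge0_pihalf// (ltW x1) andbT ltW//.
by rewrite (lt_trans _ x0)// oppr_lt0 divr_gt0 ?pi_gt0.
Qed.

Lemma wallis_decr n : wallis n.+1 <= wallis n.
Proof.
rewrite -subr_ge0 /wallis.
have df x : 0 <= x <= pi / 2 -> is_derive x 1
    (cos_primitive n - cos_primitive n.+1) (cos x ^+ n - cos x ^+ n.+1).
  by move=> _; apply: is_deriveB; exact: is_derive_cos_primitive.
have : (cos_primitive n - cos_primitive n.+1) 0 <=
       (cos_primitive n - cos_primitive n.+1) (pi / 2).
  apply: (le_of_derive_ge0 _ df); first by rewrite divr_ge0 ?pi_ge0.
  move=> x /cos_itv/andP[c0 c1].
  by rewrite exprS -{1}[cos x ^+ n]mul1r -mulrBl mulr_ge0 ?subr_ge0 ?exprn_ge0.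
by rewrite !fctE !cos_primitive0 subr0.
Qed.

Lemma wallis_prod n : n.+1%:R * wallis n.+1 * wallis n = pi / 2.
Proof.
elim: n => [|n IH]; first by rewrite /wallis/= sin_pihalf !mul1r.
by rewrite wallisSS mulrAC.
Qed.

Lemma wallis_even m :
  'C(m.*2, m)%:R / 4 ^+ m * (pi / 2) = wallis m.*2.
Proof.
elim: m => [|m IH]; first by rewrite /wallis/= bin0 expr0 divr1 mul1r.
have m2 : m.*2.+2%:R != 0 :> R by rewrite pnatr_eq0.
have m1 : m.+1%:R != 0 :> R by rewrite pnatr_eq0.
rewrite doubleS; apply: (mulfI m2); rewrite wallisSS -IH.
have binE : 'C(m.*2.+2, m.+1)%:R = 2 * m.*2.+1%:R / m.+1%:R * 'C(m.*2, m)%:R :> R.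
  have : (m.+1 * 'C(m.*2.+2, m.+1) = 2 * m.*2.+1 * 'C(m.*2, m))%N.
    rewrite -mul_bin_diag -mulnA [(m.*2.+1 * _)%N]mul_bin_down /=.
    by rewrite mulnA; congr (_ * _)%N; lia.
  move=> /(congr1 (fun k => k%:R : R)); rewrite !natrM => h.
  by apply: (mulfI m1); rewrite h; field.
rewrite binE exprS -[m.*2.+2]/(m.+1).*2 -muln2 natrM.
by field; rewrite expf_neq0 ?pnatr_eq0// nat1r pnatr_eq0.
Qed.

(** The Wallis integrals decrease, hence
    [wallis (2 * m) ^+ 2 <= wallis (2 * m) * wallis (2 * m - 1) = pi / (4 * m)]. *)
Lemma central_binomial_le m : (0 < m)%N ->
  ('C(m.*2, m)%:R / 4 ^+ m) ^+ 2 <= (pi * m%:R)^-1 :> R.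
Proof.
case: m => // m _.
have p0 := @pi_gt0 R.
have m0 : 0 < m.+1%:R :> R by rewrite ltr0n.
have := wallis_decr m.*2.+1; have := wallis_prod m.*2.+1.
rewrite -doubleS -wallis_even; set w := _ / _.
have w0 : 0 <= w by rewrite divr_ge0 ?exprn_ge0.
rewrite -muln2 natrM => wp wd.
have : m.+1%:R * 2 * (w * (pi / 2)) ^+ 2 <= pi / 2.
  by rewrite -[leRHS]wp expr2 mulrA ler_wpM2l// !mulr_ge0 ?pi_ge0.
rewrite (_ : _ * 2 * _ = w ^+ 2 * (pi * m.+1%:R) * (pi / 2)); last by field.
rewrite -[leRHS]mul1r ler_pM2r ?divr_gt0// => h.
by rewrite -[leRHS]div1r ler_pdivlMr ?mulr_gt0.
Qed.

(** The integral of [cos * (1 - cos) ^+ 3] over the first quarter of the period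
    is [3 - 15 * pi / 16], and it is nonnegative. *)
Lemma pi_le_16_5 : pi <= 16 / 5 :> R.
Proof.
pose f : R -> R := (cos_primitive 1 + 3 \*: cos_primitive 3) -
  (3 \*: cos_primitive 2 + cos_primitive 4).
have df x : 0 <= x <= pi / 2 -> is_derive x 1 f (cos x * (1 - cos x) ^+ 3).
  move=> _; have d := is_derive_cos_primitive.
  apply: (is_derive_eq (is_deriveB (is_deriveD (d 1%N x) (is_deriveZ 3 (d 3%N x)))
    (is_deriveD (is_deriveZ 3 (d 2%N x)) (d 4%N x)))).
  by rewrite /GRing.scale/=; ring.
have : f 0 <= f (pi / 2).
  apply: (le_of_derive_ge0 _ df); first by rewrite divr_ge0 ?pi_ge0.
  by move=> x /cos_itv/andP[c0 c1]; rewrite mulr_ge0 ?exprn_ge0 ?subr_ge0.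
have fE x : f x = cos_primitive 1 x + 3 * cos_primitive 3 x -
  (3 * cos_primitive 2 x + cos_primitive 4 x) by [].
rewrite !fE !cos_primitive0 -!/(wallis _).
have W0 : wallis 0 = pi / 2 by [].
have W1 : wallis 1 = 1 by exact: sin_pihalf.
have := wallisSS 0; have := wallisSS 1; have := wallisSS 2.
rewrite W0 W1; lra.
Qed.

End Calculus.

(** * The symmetric binomial law *)

Section SymmetricBinomial.
Context {R : realType}.
Implicit Types (n j k m : nat).

Definition bintail n j : R := pbtail (nseq n 2^-1) j.

Lemma bintailE n j :
  bintail n j = (\sum_(j <= i < n.+1) 'C(n, i))%N%:R / 2 ^+ n.
Proof.
rewrite /bintail pbtail_nseq natr_sum mulr_suml.
apply: eq_big_nat => i /andP[_]; rewrite ltnS => ni.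
rewrite /binmass (_ : 1 - 2^-1 = 2^-1); last by field.
by rewrite -mulrA -exprD subnKC// exprVn.
Qed.

Lemma bintail_le_half n j : (n < j.*2)%N -> bintail n j <= 2^-1.
Proof.
move=> nj; have [jn|nj'] := leqP j n.+1; last first.
  by rewrite bintailE big_geq ?mul0r ?invr_ge0// ltnW.
have sum_all : (\sum_(0 <= i < n.+1) 'C(n, i))%N%:R = 2 ^+ n :> R.
  by have := bintailE n 0; rewrite /bintail pbtail0 => /esym/divr1_eq.
have : (\sum_(j <= i < n.+1) 'C(n, i) + \sum_(j <= i < n.+1) 'C(n, i) <=
    \sum_(0 <= i < n.+1) 'C(n, i))%N.
  rewrite [leqRHS](@big_cat_nat _ _ _ j)//= leq_add2r.
  rewrite -[X in (\sum_(X <= _ < _) _)%N]add0n big_addn big_nat_rev/= add0n.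
  rewrite [leqRHS](@big_cat_nat _ _ _ (n.+1 - j))//=; last by lia.
  apply: leq_trans (leq_addr _ _); rewrite leq_eqVlt; apply/orP; left.
  apply/eqP/eq_big_nat => i /andP[_ ij]; rewrite -bin_sub; last by lia.
  by congr 'C(_, _); lia.
rewrite -(ler_nat R) natrD sum_all bintailE => h.
by rewrite ler_pdivrMr ?exprn_gt0//; lra.
Qed.

(** The sum of [(2 * i - n) * 'C(n, i)] over [i >= j] telescopes to
    [j * 'C(n, j)], because [i.+1 * 'C(n, i.+1) = (n - i) * 'C(n, i)]. *)
Lemma bintail_le_mass n j :
  (j.*2%:R - n%:R) * bintail n j <= j%:R * ('C(n, j)%:R / 2 ^+ n).
Proof.
rewrite bintailE !mulrA ler_pM2r ?invr_gt0 ?exprn_gt0//.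
have -> : j%:R * 'C(n, j)%:R =
    \sum_(j <= i < n.+1) (i.*2%:R - n%:R) * 'C(n, i)%:R :> R.
  have [jn|nj] := leqP j n; last first.
    by rewrite big_geq// bin_small// mulr0.
  under eq_big_nat => i /andP[_ ni].
    have -> : (i.*2%:R - n%:R) * 'C(n, i)%:R =
      - (i.+1 * 'C(n, i.+1))%:R - (- (i * 'C(n, i))%:R) :> R.
      by rewrite mul_bin_left !natrM natrB// -muln2 natrM; ring.
    over.
  rewrite telescope_sumr; last exact: leqW.
  by rewrite opprK (@bin_small n n.+1)// muln0 oppr0 add0r natrM.
rewrite natr_sum mulr_sumr; apply: ler_sum_nat => i /andP[ji _].
by rewrite ler_wpM2r// lerD2r ler_nat leq_double.
Qed.

(** The polynomial in [k] whose increment from [k] to [k + 2] is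
    [2 * t + 2 / 3 * t ^+ 3] with [t = (k + 1) / (n + 1)]; up to lower order
    terms it is [k ^ 2 / (2 * n) + k ^ 4 / (12 * n ^ 3)]. *)
Definition mass_exponent n k : R :=
  k%:R ^+ 2 / (2 * n.+1%:R) + (k%:R ^+ 4 - 2 * k%:R ^+ 2) / (12 * n.+1%:R ^+ 3).

Lemma binmass_ratio n j : (n <= j.*2)%N -> (j <= n)%N ->
  'C(n, j.+1)%:R <= 'C(n, j)%:R *
    expR (mass_exponent n (j.*2 - n) - mass_exponent n (j.+1.*2 - n)) :> R.
Proof.
move=> nj jn.
have N0 : n.+1%:R != 0 :> R by rewrite pnatr_eq0.
have J0 : j.+1%:R != 0 :> R by rewrite pnatr_eq0.
pose t : R := (j.*2.+1 - n)%:R / n.+1%:R.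
have t01 : 0 <= t <= 1.
  by rewrite divr_ge0//= ler_pdivrMr ?ltr0n// mul1r ler_nat; lia.
have kE : (j.*2.+1 - n)%:R = 2 * j%:R + 1 - n%:R :> R.
  by rewrite natrB ?leqW// -natr1 -muln2 natrM; ring.
have N1 : n.+1%:R = n%:R + 1 :> R by rewrite natr1.
have J1 : j.+1%:R = j%:R + 1 :> R by rewrite natr1.
have -> : 'C(n, j.+1)%:R = 'C(n, j)%:R * ((1 - t) / (1 + t)) :> R.
  apply: (mulfI J0); rewrite -natrM mul_bin_left natrM natrB//.
  have -> : (1 - t) / (1 + t) = (n%:R - j%:R) / j.+1%:R.
    rewrite /t kE; rewrite N1 in N0 *; rewrite J1 in J0 *.
    field; rewrite J0 N0 /=.
    by rewrite (_ : n%:R + 1 + (2 * j%:R + 1 - n%:R) = 2 * (j%:R + 1)) ?mulf_neq0//; ring.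
  by field.
rewrite ler_wpM2l//; apply: le_trans (ratio_le_expR t01) _.
rewrite ler_expR le_eqVlt; apply/orP; left; apply/eqP.
rewrite /mass_exponent /t.
have -> : (j.*2 - n)%:R = (j.*2.+1 - n)%:R - 1 :> R by rewrite subSn// -natr1 addrK.
have -> : (j.+1.*2 - n)%:R = (j.*2.+1 - n)%:R + 1 :> R.
  by rewrite natr1 doubleS subSn// leqW.
by field.
Qed.

Lemma normal_scale_sqr n :
  (2 / Num.sqrt n%:R * (Num.sqrt (2 * pi))^-1) ^+ 2 = 2 / (pi * n%:R) :> R.
Proof.
have [->|n0] := posnP n; first by rewrite sqrtr0 invr0 mulr0 mul0r expr0n mulr0 invr0 mulr0.
have p0 : pi != 0 :> R by rewrite gt_eqF// pi_gt0.
have nn0 : n%:R != 0 :> R by rewrite pnatr_eq0 -lt0n.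
rewrite !exprMn !exprVn !sqr_sqrtr ?mulr_ge0 ?pi_ge0//.
by move: p0; move: (pi : R) => p p0; field; rewrite nn0.
Qed.

(** Local limit bound: the ratios [binmass_ratio] are multiplied from the centre
    outwards, starting from the central binomial coefficient. *)
Lemma binmass_le n j : (0 < n)%N -> (n <= j.*2)%N -> (j <= n)%N ->
  'C(n, j)%:R / 2 ^+ n <=
  2 / Num.sqrt n%:R * (Num.sqrt (2 * pi))^-1 * expR (- mass_exponent n (j.*2 - n)).
Proof.
move=> n0; elim: j => [|j IH]; first by lia.
set c := 2 / _ * _ in IH *.
have c0 : 0 <= c by rewrite mulr_ge0// ?divr_ge0 ?invr_ge0 ?sqrtr_ge0.
move=> nj jn; have [nj'|jn'] := leqP n j.*2.
  have h := binmass_ratio nj' (ltnW jn).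
  apply: (@le_trans _ _ ('C(n, j)%:R / 2 ^+ n *
      expR (mass_exponent n (j.*2 - n) - mass_exponent n (j.+1.*2 - n)))).
    by rewrite mulrAC ler_wpM2r ?invr_ge0 ?exprn_ge0.
  apply: le_trans (ler_wpM2r (expR_ge0 _) (IH nj' (ltnW jn))) _.
  by rewrite -mulrA -expRD addrA addNr sub0r.
have central : ('C(j.+1.*2, j.+1)%:R / 4 ^+ j.+1) ^+ 2 <= (pi * j.+1%:R)^-1 :> R.
  exact: central_binomial_le.
have b0 m i : 0 <= 'C(m, i)%:R / 2 ^+ m :> R by rewrite divr_ge0 ?exprn_ge0.
have p0 : 0 < pi :> R := pi_gt0 _.
have four m : 4 ^+ m = 2 ^+ m.*2 :> R by rewrite -muln2 mulnC exprM; congr (_ ^+ _); ring.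
rewrite -ler_sqr ?nnegrE ?mulr_ge0 ?expR_ge0//.
move: nj; rewrite leq_eqVlt => /predU1P[nE|nj].
  rewrite nE subnn /mass_exponent !expr0n /= mulr0 subrr !mul0r addr0 oppr0 expR0.
  rewrite mulr1 /c normal_scale_sqr nE -four; apply: le_trans central _.
  rewrite -muln2 natrM le_eqVlt; apply/orP; left; apply/eqP.
  by move: p0; move: (pi : R) => p p0; field; rewrite nat1r pnatr_eq0 /= gt_eqF.
have nE : n = j.*2.+1 by lia.
rewrite (_ : j.+1.*2 - n = 1)%N; last by lia.
have -> : 'C(n, j.+1)%:R / 2 ^+ n = 'C(j.+1.*2, j.+1)%:R / 4 ^+ j.+1 :> R.
  rewrite four doubleS -nE binS [X in _ = (_ + X)%:R / _](_ : _ = 'C(n, j.+1)).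
    by rewrite exprS natrD; field; rewrite expf_neq0.
  by rewrite -bin_sub; [congr 'C(_, _)|]; lia.
apply: le_trans central _; rewrite exprMn normal_scale_sqr expr2 -expRD.
have N0 : 0 < n.+1%:R :> R by rewrite ltr0n.
have nn0 : 0 < n%:R :> R by rewrite ltr0n.
have -> : (pi * j.+1%:R)^-1 = 2 / (pi * n%:R) * (1 - n.+1%:R^-1) :> R.
  have -> : j.+1%:R = n.+1%:R / 2 :> R.
    by rewrite nE -doubleS -muln2 natrM; field.
  have n1 : n.+1%:R = n%:R + 1 :> R by rewrite natr1.
  rewrite n1 in N0 *; move: p0; move: (pi : R) => p p0.
  by field; rewrite !gt_eqF.
rewrite ler_wpM2l ?divr_ge0 ?mulr_ge0 ?pi_ge0//.
apply: le_trans (expR_ge1Dx _) _; rewrite ler_expR /mass_exponent !expr1n.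
rewrite -subr_ge0.
set N := n.+1%:R in N0 *.
rewrite (_ : _ - _ = (6 * N ^+ 3)^-1); last by field; rewrite gt_eqF.
by rewrite invr_ge0 mulr_ge0 ?exprn_ge0 ?ltW.
Qed.

End SymmetricBinomial.

(** * Lower bounds for the normal tail and for Q *)

Section NormalTail.
Context {R : realType}.
Implicit Types (a b t x : R) (A B : set R).

Lemma std_normal_pdf_gt0 x : 0 < std_normal_pdf x.
Proof.
by rewrite std_normal_pdfE mulr_gt0 ?expR_gt0// invr_gt0 sqrtr_gt0 mulr_gt0// pi_gt0.
Qed.

Lemma continuous_std_normal_pdf : continuous (@std_normal_pdf R).
Proof. by apply: continuous_normal_pdf; rewrite oner_eq0. Qed.

Lemma std_normal_pdfN x : std_normal_pdf (- x) = std_normal_pdf x.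
Proof. by rewrite !std_normal_pdfE sqrrN. Qed.

Lemma le_std_normal_pdf x y : `|x| <= `|y| -> std_normal_pdf y <= std_normal_pdf x.
Proof.
move=> xy; rewrite !std_normal_pdfE ler_wpM2l ?invr_ge0 ?sqrtr_ge0//.
rewrite ler_expR !mulNr lerN2 ler_pM2r ?invr_gt0//.
rewrite -(real_normK (num_real x)) -(real_normK (num_real y)).
by rewrite lerXn2r ?nnegrE.
Qed.

Lemma std_normal_fin_num A : measurable A -> normal_prob 0 1 A \is a fin_num.
Proof. by move=> mA; apply: fin_num_measure. Qed.

Lemma le_std_normal_prob A B : measurable A -> measurable B -> A `<=` B ->
  std_normal_prob A <= std_normal_prob B.
Proof.
move=> mA mB AB; rewrite /std_normal_prob fine_le ?std_normal_fin_num//.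
by rewrite le_measure ?inE.
Qed.

Let measurable_pdf A : measurable A ->
  measurable_fun A (EFin \o (normal_pdf (0 : R) 1)).
Proof.
move=> mA; apply/measurable_EFinP/measurable_funTS; exact: measurable_normal_pdf.
Qed.

Lemma std_normal_prob_gt a :
  std_normal_prob [set z | a < z] = std_normal_prob `[a, +oo[.
Proof.
rewrite /std_normal_prob /normal_prob -set_itvoy integral_itv_obnd_cbnd//.
by apply: measurable_pdf.
Qed.

Lemma std_normal_prob_absE t :
  std_normal_prob [set z | `|z| < t] = std_normal_prob `[- t, t].
Proof.
have -> : [set z | `|z| < t] = `]- t, t[%classic.
  by apply/seteqP; split => z /=; rewrite in_itv/= ltr_norml.
rewrite /std_normal_prob /normal_prob.
by rewrite -(@integral_itv_bndoo _ _ _ _ true false)//; exact: measurable_pdf.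
Qed.

(** The lower tail has the same probability as the upper one by symmetry; the
    three sets overlap only in null sets when [t >= 0]. *)
Lemma std_normal_cover t :
  1 <= std_normal_prob [set z | `|z| < t] + 2 * std_normal_prob [set z | t < z].
Proof.
pose A := `]-oo, - t]%classic; pose B := `[- t, t]%classic; pose C := `[t, +oo[%classic.
have symAC : normal_prob 0 1 A = normal_prob 0 1 C.
  rewrite /normal_prob ge0_integration_by_substitutionNy.
  - by apply: eq_integral => x _ /=; rewrite -/(std_normal_pdf _) std_normal_pdfN.
  - exact: (continuous_subspaceT continuous_std_normal_pdf).
  - by move=> x _; exact: normal_pdf_ge0.
have mA : measurable A by exact: measurable_itv.
have mB : measurable B by exact: measurable_itv.
have mC : measurable C by exact: measurable_itv.
rewrite std_normal_prob_gt std_normal_prob_absE -/B -/C.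
have : (1 <= normal_prob 0 1 A + (normal_prob 0 1 B + normal_prob 0 1 C))%E.
  rewrite -(@probability_setT _ _ R (normal_prob 0 1)).
  apply: (@le_trans _ _ (normal_prob 0 1 (A `|` (B `|` C)))).
    apply: le_measure; rewrite ?inE//; first by do ! apply: measurableU.
    move=> x _ /=; rewrite /A /B /C /= !in_itv/= andbT.
    case: (leP x (- t)) => xt; first by left.
    by right; case: (leP t x) => tx; [right|left; rewrite !ltW].
  apply: le_trans (measureU2 _ _ _) _ => //; first exact: measurableU.
  by rewrite leeD2l// measureU2.
rewrite symAC /std_normal_prob => h; rewrite -lee_fin EFinD EFinM.
rewrite !fineK ?std_normal_fin_num//; apply: le_trans h _.
by rewrite addeCA -mule2n mule_natl.
Qed.

Lemma std_normal_prob_ge_ftc (F f : R -> R) a b : a < b ->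
  (forall x, is_derive x 1 F (f x)) -> continuous f ->
  (forall x, a <= x <= b -> f x <= std_normal_pdf x) ->
  F b - F a <= std_normal_prob `[a, b].
Proof.
move=> ab dF cf fpdf.
have cF : continuous F.
  by move=> x; apply/differentiable_continuous/derivable1_diffP; case: (dF x).
rewrite -lee_fin fineK ?std_normal_fin_num// EFinB -(@continuous_FTC2 _ f F a b)//.
- apply: le_integral => //.
  + apply: continuous_compact_integrable; first exact: segment_compact.
    exact: continuous_subspaceT.
  + apply: continuous_compact_integrable; first exact: segment_compact.
    exact: (continuous_subspaceT continuous_std_normal_pdf).
  + by move=> x; rewrite inE/= in_itv/= => axb; rewrite lee_fin fpdf.
- exact: continuous_subspaceT.
- split; first by move=> x _; case: (dF x).
  + exact/cvg_at_right_filter/cF.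
  + exact/cvg_at_left_filter/cF.
- by move=> x _; rewrite derive1E; case: (dF x).
Qed.

Lemma is_derive_std_normal_pdf x :
  is_derive x 1 (@std_normal_pdf R) (- x * std_normal_pdf x).
Proof.
pose c : R := (Num.sqrt (2 * pi))^-1.
have -> : @std_normal_pdf R = fun x => c * expR (- x ^+ 2 / 2).
  by apply/funext => y; exact: std_normal_pdfE.
have dq : is_derive x 1 (fun x : R => - x ^+ 2 / 2) (- x).
  by apply: is_derive_eq; rewrite /GRing.scale/=; field.
apply: (is_derive_eq (is_derive1M (is_derive_cst c x 1) (is_derive1_expR dq))).
by rewrite /cst /=; move: c => c; ring.
Qed.

Lemma continuous_of_derive (f f' : R -> R) :
  (forall x, is_derive x 1 f (f' x)) -> continuous f.
Proof.
by move=> df x; apply/differentiable_continuous/derivable1_diffP; case: (df x).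
Qed.

(** Gordon's lower bound for the Mills ratio: minus the density times
    [x / (1 + x ^+ 2)] is a primitive of the density times
    [1 - 2 / (1 + x ^+ 2) ^+ 2], and it vanishes at infinity. *)
Lemma std_normal_tail_ge a : 0 < a ->
  std_normal_pdf a * (a / (1 + a ^+ 2)) <= std_normal_prob [set z | a < z].
Proof.
move=> a0; pose d x : R := 1 + x ^+ 2.
have d0 x : d x != 0 by rewrite /d gt_eqF//; nra.
have dd x : is_derive x 1 d (2 * x).
  by rewrite /d; apply: is_derive_eq; rewrite /GRing.scale/=; ring.
have dV x := is_derive1V (d0 x) (dd x).
pose F x : R := - std_normal_pdf x * (x * (d x)^-1).
pose f x := std_normal_pdf x * (1 - 2 * (d x)^-1 ^+ 2).
have dF x : is_derive x 1 F (f x).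
  apply: (is_derive_eq (is_derive1M (is_deriveN (is_derive_std_normal_pdf x))
    (is_derive1M (is_derive_id x 1) (dV x)))).
  by rewrite /f fctE; have := d0 x; rewrite /d => ?; field.
have cf : continuous f.
  apply: (@continuous_of_derive _ (fun x => - x * std_normal_pdf x *
    (1 - 2 * (d x)^-1 ^+ 2) + std_normal_pdf x *
    (0 - (0 * (d x)^-1 ^+ 2 + 2 * (2%:R * (d x)^-1 ^+ 1 * (- (2 * x) / d x ^+ 2)))))).
  move=> x; apply: is_derive1M; first exact: is_derive_std_normal_pdf.
  apply: is_deriveB; apply: is_derive1M; exact: is_derive1X.
have f_le x : f x <= std_normal_pdf x.
  rewrite /f ler_piMr ?(ltW (std_normal_pdf_gt0 _))// gerBl.
  by rewrite mulr_ge0// sqr_ge0.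
rewrite std_normal_prob_gt; apply/ler_addgt0Pr => e e0.
(* far enough out for the boundary term, at most 1 / b, to be below e *)
pose b := a + 1 + e^-1.
have b0 : 0 < b by rewrite !addr_gt0 ?invr_gt0.
have e'0 : 0 < e^-1 by rewrite invr_gt0.
have ab : a < b by rewrite /b; lra.
have := std_normal_prob_ge_ftc ab dF cf (fun x _ => f_le x).
have : std_normal_prob `[a, b] <= std_normal_prob `[a, +oo[ :> R.
  apply: le_std_normal_prob => // x /=; rewrite !in_itv/= andbT.
  by case/andP.
suff : - F b <= e by rewrite /F /d mulNr; lra.
have pdf1 : std_normal_pdf b <= 1.
  rewrite std_normal_pdfE -[leRHS]mulr1 ler_pM ?invr_ge0 ?sqrtr_ge0 ?expR_ge0//.
    rewrite invf_le1 ?sqrtr_gt0 ?mulr_gt0 ?pi_gt0//.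
    by rewrite -[leLHS]sqrtr1 ler_sqrt ?mulr_ge0 ?pi_ge0//;
      have := @pi_ge2 R; move: (@pi R) => p; lra.
  by rewrite expR_le1 mulNr oppr_le0 divr_ge0 ?sqr_ge0.
apply: (@le_trans _ _ (1 * b^-1)).
  rewrite /F mulNr opprK ler_pM ?(ltW (std_normal_pdf_gt0 _))//.
    by rewrite divr_ge0 ?(ltW b0)// /d addr_ge0 ?sqr_ge0.
  rewrite /d -[b^-1]div1r ler_pdivrMr; last by rewrite ltr_pwDl ?sqr_ge0.
  by rewrite mulrAC mul1r ler_pdivlMr //; lra.
rewrite mul1r -[leRHS]invrK lef_pV2 ?posrE ?invr_gt0//.
by rewrite /b; lra.
Qed.

Lemma sqrt_expR1 : Num.sqrt (expR 1) = expR 2^-1 :> R.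
Proof.
have -> : expR 1 = expR 2^-1 ^+ 2 :> R by rewrite expr2 -expRD; congr expR; field.
by rewrite sqrtr_sqr ger0_norm ?expR_ge0.
Qed.

(** [constC] is 10 times the integral over [0, 1] of [expR ((1 - x ^+ 2) / 2)];
    the Taylor polynomial of degree 2 of the exponential has integral 7 / 5. *)
Lemma constC_ge14 : 14 <= constC :> R.
Proof.
pose c : R := (Num.sqrt (2 * pi))^-1 * expR (- 2^-1).
pose F (x : R) : R := c * (x + (x - x ^+ 3 / 3) / 2 + (x - 2 * x ^+ 3 / 3 + x ^+ 5 / 5) / 8).
pose f (x : R) : R := c * (1 + (1 - x ^+ 2) / 2 + ((1 - x ^+ 2) / 2) ^+ 2 / 2).
have sp0 : 0 < Num.sqrt (2 * pi) :> R by rewrite sqrtr_gt0 mulr_gt0// pi_gt0.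
have c0 : 0 <= c by rewrite mulr_ge0 ?expR_ge0// invr_ge0 ltW.
have dF x : is_derive x 1 F (f x).
  rewrite /F /f; move: (c) => k.
  by apply: is_derive_eq; rewrite /GRing.scale/=; field.
have cf : continuous f.
  apply: (@continuous_of_derive _ (fun x => c * (- x - x * (1 - x ^+ 2) / 2))) => x.
  rewrite /f; move: (c) => k.
  by apply: is_derive_eq; rewrite /GRing.scale/=; field.
have N11 : -1 < 1 :> R by lra.
have := std_normal_prob_ge_ftc N11 dF cf.
have -> : F 1 - F (-1) = 14 / 5 * c by rewrite /F; move: (c) => k; field.
rewrite -std_normal_prob_absE => h.
have {}h : 14 / 5 * c <= std_normal_prob [set z | `|z| < 1].
  apply: h => x /andP[x1 x2].
  rewrite std_normal_pdfE /f /c -mulrA ler_wpM2l ?invr_ge0 ?(ltW sp0)//.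
  rewrite (_ : - x ^+ 2 / 2 = - 2^-1 + (1 - x ^+ 2) / 2); last by field.
  rewrite expRD ler_wpM2l ?expR_ge0// expR_ge_taylor2//.
  by rewrite divr_ge0// subr_ge0; nra.
rewrite /constC sqrtrM ?mulr_ge0 ?pi_ge0// sqrt_expR1.
apply: (@le_trans _ _ (5 * (Num.sqrt (2 * pi) * expR 2^-1) * (14 / 5 * c))); last first.
  by rewrite ler_wpM2l// mulr_ge0// mulr_ge0 ?expR_ge0// ltW.
rewrite /c expRN; have e0 := @expR_gt0 R 2^-1.
move: sp0 e0; move: (Num.sqrt _) (expR _) => u v u0 v0.
by rewrite le_eqVlt; apply/orP; left; apply/eqP; field; rewrite !gt_eqF.
Qed.

Lemma Qfun_ge_tail_ratio a : 0 < a -> std_normal_pdf a * tail_ratio a <= Qfun a.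
Proof.
move=> a0; rewrite /Qfun /tail_ratio mulrDr lerD ?std_normal_tail_ge//.
rewrite mulrA [_ * 14]mulrC ler_pM2r ?invr_gt0; last by rewrite ltr_pwDl ?sqr_ge0.
by rewrite ler_pM2r ?std_normal_pdf_gt0// constC_ge14.
Qed.

Let constC_ge0 : 0 <= constC :> R.
Proof. by rewrite (le_trans _ constC_ge14). Qed.

(** By the choice of [constC], the second term of [Qfun 1] is half the
    probability of the interval from -1 to 1. *)
Lemma half_le_Qfun1 : 2^-1 <= Qfun 1 :> R.
Proof.
have s0 : 0 < Num.sqrt (2 * pi) :> R by rewrite sqrtr_gt0 mulr_gt0// pi_gt0.
have e0 := @expR_gt0 R 2^-1.
have := std_normal_cover 1.
rewrite /Qfun.
have -> : constC * std_normal_pdf 1 / (9 + 1 ^+ 2) =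
    std_normal_prob [set z : R | `|z| < 1] / 2 :> R.
  rewrite /constC std_normal_pdfE sqrtrM ?mulr_ge0 ?pi_ge0// sqrt_expR1.
  rewrite (_ : - 1 ^+ 2 / 2 = - 2^-1 :> R) ?expRN; last by field.
  move: s0 e0; move: (Num.sqrt _) (expR _) (std_normal_prob _) => u v w u0 v0.
  by field; rewrite !gt_eqF.
lra.
Qed.

Lemma half_le_Qfun t : `|t| <= 1 -> 2^-1 <= Qfun t.
Proof.
move=> t1; apply: le_trans half_le_Qfun1 _; rewrite /Qfun lerD//.
  apply: le_std_normal_prob; rewrite -?set_itvoy// => x /=; rewrite !in_itv/= !andbT.
  by apply: le_lt_trans; rewrite (le_trans (ler_norm _)).
rewrite -[leLHS]mulrA -[leRHS]mulrA ler_wpM2l//.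
rewrite ler_pM ?(ltW (std_normal_pdf_gt0 _)) ?invr_ge0//.
  by rewrite le_std_normal_pdf// [leRHS]ger0_norm.
have tt : t ^+ 2 <= 1 by rewrite -(real_normK (num_real t)) expr_le1.
by rewrite lef_pV2 ?posrE ?ltr_pwDl ?sqr_ge0// expr1n lerD2l.
Qed.

Lemma one_le_Qfun0 : 1 <= Qfun 0 :> R.
Proof.
rewrite /Qfun expr0n /= addr0.
have N0 : std_normal_prob [set z : R | `|z| < 0] = 0.
  rewrite (_ : [set z : R | _] = set0) /std_normal_prob ?measure0//.
  by apply/seteqP; split => // z /=; rewrite ltNge normr_ge0.
have := std_normal_cover (0 : R); rewrite N0 => c0.
have pdf0 : 2^-1 <= 14 * std_normal_pdf 0 / 9 :> R.
  rewrite std_normal_pdfE expr0n /= oppr0 mul0r expR0 mulr1.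
  rewrite mulrAC ler_pdivlMr ?sqrtr_gt0 ?mulr_gt0 ?pi_gt0//.
  suff : Num.sqrt (2 * pi) <= 14 / 5 :> R by lra.
  have -> : 14 / 5 = Num.sqrt ((14 / 5) ^+ 2) :> R.
    by rewrite sqrtr_sqr ger0_norm.
  by rewrite ler_sqrt ?sqr_ge0//; have := @pi_le_16_5 R; move: (@pi R) => p; lra.
have : 14 * std_normal_pdf 0 / 9 <= constC * std_normal_pdf 0 / 9 :> R.
  by rewrite ler_pM2r// ler_pM2r ?std_normal_pdf_gt0// constC_ge14.
lra.
Qed.

End NormalTail.

(** * The symmetric binomial tail is dominated by Q on its lattice *)

Section BinomialTailBound.
Context {R : realType}.
Implicit Types (n j k : nat).

Let Qfun_ge0 (t : R) : 0 <= t -> 0 <= Qfun t.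
Proof.
rewrite le_eqVlt => /predU1P[<-|t0]; first by rewrite (le_trans _ one_le_Qfun0).
apply: le_trans (Qfun_ge_tail_ratio t0).
rewrite mulr_ge0 ?(ltW (std_normal_pdf_gt0 _))//.
by rewrite addr_ge0// divr_ge0 ?addr_ge0 ?sqr_ge0 ?(ltW t0).
Qed.

Lemma expRN_half_ge : 97 / 160 <= expR (- 2^-1) :> R.
Proof.
have /ratio_le_expR : 0 <= (4^-1 : R) <= 1 by lra.
rewrite (_ : - (2 * 4^-1 + 2 / 3 * 4^-1 ^+ 3) = - 2^-1 + - 96^-1 :> R); last by field.
rewrite expRD => h; have := expR_ge1Dx (96^-1 : R).
have : expR (- 96^-1) * expR 96^-1 = 1 :> R by rewrite -expRD addNr expR0.
have := expR_gt0 (- 96^-1 : R); have := expR_gt0 (- 2^-1 : R).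
move: h; move: (expR _) (expR _) (expR _) => u v w.
have -> : (1 - 4^-1) / (1 + 4^-1) = 3 / 5 :> R by field.
nra.
Qed.

Lemma sqrt_2pi_le : Num.sqrt (2 * pi) <= 253 / 100 :> R.
Proof.
have -> : 253 / 100 = Num.sqrt ((253 / 100) ^+ 2) :> R by rewrite sqrtr_sqr ger0_norm.
by rewrite ler_sqrt ?sqr_ge0//; have := @pi_le_16_5 R; move: (@pi R) => p; lra.
Qed.

(** A numerical criterion at [a = sqrt m]: 97/160 is below [expR (- 1 / 2)], and
    253/100 is above [sqrt (2 * pi)]. *)
Lemma pow2_le_Qfun (a : R) m : 0 < a -> a ^+ 2 = m%:R ->
  (2 ^- m) * (253 / 100) <= (97 / 160) ^+ m * tail_ratio a -> 2 ^- m <= Qfun a.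
Proof.
move=> a0 am le; apply: le_trans (Qfun_ge_tail_ratio a0).
have s0 : 0 < Num.sqrt (2 * pi) :> R by rewrite sqrtr_gt0 mulr_gt0// pi_gt0.
rewrite std_normal_pdfE am mulrAC -mulrA mulrC ler_pdivlMr//.
have -> : expR (- m%:R / 2) = expR (- 2^-1) ^+ m :> R.
  by rewrite -expRM_natl; congr expR; rewrite mulNr mulrN.
apply: (@le_trans _ _ (2 ^- m * (253 / 100))).
  by rewrite ler_wpM2l ?sqrt_2pi_le// invr_ge0 exprn_ge0.
apply: le_trans le _; rewrite mulrC ler_wpM2l//.
  by rewrite addr_ge0// divr_ge0 ?addr_ge0 ?sqr_ge0 ?(ltW a0).
by rewrite lerXn2r ?nnegrE ?expR_ge0 ?expRN_half_ge//; lra.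
Qed.

Lemma bintail_nn n : bintail n n = 2 ^- n :> R.
Proof. by rewrite bintailE big_nat1 binn mul1r. Qed.

Lemma bintail2_le_Qfun : bintail 2 2 <= Qfun (2 / Num.sqrt 2) :> R.
Proof.
have s2 : Num.sqrt 2 ^+ 2 = 2 :> R by rewrite sqr_sqrtr.
have s0 : 0 < Num.sqrt 2 :> R by rewrite sqrtr_gt0.
have aE : 2 / Num.sqrt 2 = Num.sqrt 2 :> R.
  by rewrite -{1}s2 expr2 mulfK// gt_eqF.
rewrite bintail_nn aE; apply: pow2_le_Qfun => //; rewrite /tail_ratio s2.
have : 141 / 100 <= Num.sqrt 2 :> R by nra.
move: (Num.sqrt 2 : R) => s ?.
rewrite (_ : s / (1 + 2) + 14 / (9 + 2) = s / 3 + 14 / 11); last by field.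
by rewrite (_ : 2 ^- 2 = 4^-1 :> R); [lra|field].
Qed.

Lemma bintail3_le_Qfun : bintail 3 3 <= Qfun (3 / Num.sqrt 3) :> R.
Proof.
have s2 : Num.sqrt 3 ^+ 2 = 3 :> R by rewrite sqr_sqrtr.
have s0 : 0 < Num.sqrt 3 :> R by rewrite sqrtr_gt0.
have aE : 3 / Num.sqrt 3 = Num.sqrt 3 :> R.
  by rewrite -{1}s2 expr2 mulfK// gt_eqF.
rewrite bintail_nn aE; apply: pow2_le_Qfun => //; rewrite /tail_ratio s2.
have : 173 / 100 <= Num.sqrt 3 :> R by nra.
move: (Num.sqrt 3 : R) => s ?.
rewrite (_ : s / (1 + 3) + 14 / (9 + 3) = s / 4 + 7 / 6); last by field.
by rewrite (_ : 2 ^- 3 = 8^-1 :> R); [lra|field].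
Qed.

(** The discrepancy between the exponents of the normal density and of
    [binmass_le], in the form required by [correction_le_tail_ratio].  The
    coefficients 4/75 and 16/375 come from [n / (n + 1) >= 4 / 5]. *)
Lemma exponent_gap_le n k (a h : R) : (4 <= n)%N -> 0 < h -> h ^+ 2 * n%:R = 1 ->
  a = k%:R * h ->
  let e := a ^+ 2 / 2 - mass_exponent n k in
  (a ^+ 2 <= 10 -> e <= 4 / 75 * a ^+ 2 * (10 - a ^+ 2) * h ^+ 2) /\
  (10 <= a ^+ 2 -> e <= 16 / 375 * a ^+ 2 * (10 - a ^+ 2) * h ^+ 2).
Proof.
move=> n4 h0 hn aE e.
pose v : R := n.+1%:R^-1; pose w : R := n%:R * v.
have n4' : 4 <= n%:R :> R by rewrite (ler_nat R 4).
have N0 : 0 < n.+1%:R :> R by rewrite ltr0n.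
have vN : v * n.+1%:R = 1 by rewrite mulVf// gt_eqF.
have v0 : 0 < v by rewrite invr_gt0.
have wv : w = 1 - v by move: vN; rewrite /w -natr1; lra.
have w45 : 4 / 5 <= w by rewrite wv; move: vN; rewrite -natr1; nra.
have v15 : v <= 5^-1 by lra.
have vh : v = h ^+ 2 * w by rewrite /w mulrA hn mul1r.
have kE : k%:R ^+ 2 = a ^+ 2 * n%:R :> R by rewrite aE exprMn -mulrA hn mulr1.
have eE : e = v * (a ^+ 2 / 2 - a ^+ 4 * w ^+ 2 / 12 + a ^+ 2 * w * v / 6).
  rewrite /e /mass_exponent kE (_ : k%:R ^+ 4 = (a ^+ 2 * n%:R) ^+ 2); last first.
    by rewrite -kE -exprM.
  rewrite /w /v -natr1; rewrite -natr1 in N0.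
  by field; rewrite gt_eqF.
have e_le : e <= v * (4 / 75 * a ^+ 2 * (10 - a ^+ 2)).
  rewrite eE ler_wpM2l ?(ltW v0)//.
  have a2 := sqr_ge0 a.
  have : a ^+ 4 * (16 / 25) <= a ^+ 4 * w ^+ 2.
    by rewrite ler_wpM2l ?exprn_even_ge0//; nra.
  have : a ^+ 2 * w * v <= a ^+ 2 * 5^-1.
    by rewrite -mulrA ler_wpM2l//; nra.
  lra.
have h20 : 0 <= h ^+ 2 by rewrite sqr_ge0.
split=> a10; apply: (le_trans e_le).
  rewrite mulrC ler_wpM2l//; last by rewrite vh ler_piMr//; lra.
  by rewrite mulr_ge0 ?subr_ge0// mulr_ge0// sqr_ge0.
have -> : 16 / 375 * a ^+ 2 * (10 - a ^+ 2) * h ^+ 2 =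
  4 / 5 * h ^+ 2 * (4 / 75 * a ^+ 2 * (10 - a ^+ 2)) by field.
rewrite ler_wnM2r//; last by rewrite vh mulrC ler_wpM2l.
by rewrite mulr_ge0_le0 ?subr_le0// mulr_ge0// sqr_ge0.
Qed.

Lemma bintail_le_Qfun n j : (0 < n)%N -> (n <= j.*2)%N ->
  bintail n j <= Qfun ((j.*2 - n)%:R / Num.sqrt n%:R) :> R.
Proof.
move=> n0 nj; set k := (j.*2 - n)%N.
have s0 : 0 < Num.sqrt n%:R :> R by rewrite sqrtr_gt0 ltr0n.
have sn : Num.sqrt n%:R ^+ 2 = n%:R :> R by rewrite sqr_sqrtr.
have [jn|nj'] := leqP j n; last first.
  by rewrite bintailE big_geq// mul0r Qfun_ge0// divr_ge0 ?sqrtr_ge0.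
have [k0|k0] := posnP k.
  rewrite k0 mul0r; apply: le_trans one_le_Qfun0; apply: pbtail_le1.
  by apply/allP => x /nseqP[-> _]; lra.
have [kn|nk] := leqP (k ^ 2) n.
  apply: (le_trans (bintail_le_half _)); first by rewrite /k in k0; lia.
  apply: half_le_Qfun; rewrite ger0_norm ?divr_ge0 ?sqrtr_ge0//.
  rewrite ler_pdivrMr// mul1r -ler_sqr ?nnegrE ?sqrtr_ge0//.
  by rewrite sn -natrX ler_nat.
have n1 : (1 < n)%N by move: nk; rewrite /k; nia.
have [n4|] := leqP 4 n; last first.
  rewrite ltnS => n3.
  have nkE : n = k by move: n1 n3 nk nj jn; rewrite /k; clear; nia.
  have jE : j = n by move: nkE; rewrite /k; lia.
  have : n = 2 \/ n = 3 by lia.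
  rewrite jE -nkE => -[->|->]; [exact: bintail2_le_Qfun|exact: bintail3_le_Qfun].
pose h : R := (Num.sqrt n%:R)^-1; pose a := k%:R * h.
have h0 : 0 < h by rewrite invr_gt0.
have a0 : 0 < a by rewrite mulr_gt0// ltr0n.
have hn : h ^+ 2 * n%:R = 1.
  by rewrite -sn /h -exprMn mulVf ?expr1n// gt_eqF.
have a1 : 1 <= a.
  rewrite -(@ler_pXn2r _ 2)// ?nnegrE ?(ltW a0)// expr1n /a exprMn.
  by rewrite -[leLHS]hn mulrC ler_wpM2r ?sqr_ge0// -natrX ler_nat ltnW.
have kn' : (k <= n)%N by rewrite /k; lia.
have ah : a * h <= 1.
  by rewrite /a -mulrA -expr2 -[leRHS]hn mulrC ler_wpM2l ?sqr_ge0 ?ler_nat.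
have h2 : 0 <= h <= 2^-1.
  rewrite ltW//= -(@ler_pXn2r _ 2)// ?nnegrE ?(ltW h0)//.
  have : 4 <= n%:R :> R by rewrite (ler_nat R 4).
  have := sqr_ge0 h; move: (hn); set x := h ^+ 2.
  by rewrite (_ : 2^-1 ^+ 2 = 4^-1 :> R); [nra|field].
have [e1 e2] := exponent_gap_le n4 h0 hn (erefl a).
have := correction_le_tail_ratio a1 h2 ah e1 e2.
set e := a ^+ 2 / 2 - mass_exponent n k => le_tr.
apply: le_trans (Qfun_ge_tail_ratio a0).
have k0' : 0 < k%:R :> R by rewrite ltr0n.
rewrite -(ler_pM2l k0').
have := bintail_le_mass (R := R) n j.
rewrite -natrB// -/k => T_le; apply: (le_trans T_le).
have b_le := binmass_le (R := R) n0 nj jn.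
apply: (le_trans (ler_wpM2l (ler0n R j) b_le)).
rewrite -/k std_normal_pdfE.
have -> : - mass_exponent n k = - a ^+ 2 / 2 + e by rewrite /e; field.
rewrite expRD.
set c := (Num.sqrt (2 * pi))^-1; set p := expR (- a ^+ 2 / 2).
have jE : j%:R = (n%:R + k%:R) / 2 :> R.
  by rewrite /k natrB// -muln2 natrM; field.
have -> : j%:R * (2 / Num.sqrt n%:R * c * (p * expR e)) =
  c * p * (k%:R * ((a^-1 + h) * expR e)).
  have kaV : k%:R * a^-1 = n%:R * h.
    apply: (mulIf (lt0r_neq0 a0)); rewrite divfK ?lt0r_neq0// /a.
    by rewrite mulrACA [_ * k%:R]mulrC -mulrA [n%:R * _]mulrC -expr2 hn mulr1.
  transitivity (c * p * expR e * (n%:R * h + k%:R * h)).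
    by rewrite jE -[2 / _]/(2 * h); move: (h) (c) (p) (expR e) => *; field.
  by rewrite -kaV; move: (a^-1) (h) (c) (p) (expR e) => *; ring.
rewrite [leRHS]mulrCA ler_wpM2l ?mulr_ge0 ?expR_ge0 ?invr_ge0 ?sqrtr_ge0// ler_wpM2l//.
apply: (@le_trans _ _ ((1 - e) * tail_ratio a * expR e)).
  by rewrite ler_wpM2r ?expR_ge0.
rewrite mulrAC ler_piMl//.
  by rewrite addr_ge0// divr_ge0 ?addr_ge0 ?sqr_ge0 ?(ltW a0).
(* exp(e) (1 - e) <= 1, since 1 - e <= exp(- e) *)
have := expR_ge1Dx (- e); have := expR_gt0 e.
have : expR e * expR (- e) = 1 by rewrite -expRD subrr expR0.
nra.
Qed.

End BinomialTailBound.

(** * Expectations of products of independent variables *)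

Section Independence.
Context (d : measure_display) (T : measurableType d) (R : realType).
Context (P : probability T R).
Import HBNNSimple.

Lemma integral_indic_RV (Y : {RV P >-> R}) (B : set R) : measurable B ->
  (\int[P]_w (\1_B (Y w))%:E = P (Y @^-1` B))%E.
Proof.
move=> mB; transitivity (\int[P]_w (\1_(Y @^-1` B) w)%:E)%E => //.
rewrite integral_indic ?setIT//.
by rewrite -[_ @^-1` _]setTI; exact: measurable_funP.
Qed.

(* If G acts on indicators of events {Y in B} as the constant c, it does so on
   all functions of Y: first simple ones, then by monotone convergence. *)
Let integral_weighted_simple (Y : {RV P >-> R}) (G : T -> R) (c : R)
    (g : {nnsfun R >-> R}) :
    measurable_fun setT G -> (forall w, 0 <= G w) -> 0 <= c ->
    (forall B : set R, measurable B ->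
      (\int[P]_w (\1_B (Y w) * G w)%:E = c%:E * P (Y @^-1` B))%E) ->
  (\int[P]_w (g (Y w) * G w)%:E = \int[P]_w (c * g (Y w))%:E)%E.
Proof.
move=> mG G0 c0 indic.
have mY B : measurable B -> measurable (Y @^-1` B).
  by move=> mB; rewrite -[_ @^-1` _]setTI; exact: measurable_funP.
have mYB B : measurable B -> measurable_fun setT (fun w => \1_B (Y w) : R).
  by move=> /mY mB; exact: (measurable_indic (D := setT) mB).
have gE y : g y = \sum_(r \in range g) (r * \1_(g @^-1` [set r]) y) by rewrite -fimfunE.
have r_ge0 r : r \in range g -> 0 <= r by rewrite inE => -[y _ <-].
have termwise (H : T -> R) : measurable_fun setT H -> (forall w, 0 <= H w) ->
    (\int[P]_w (g (Y w) * H w)%:E = \sum_(r \in range g)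
      r%:E * \int[P]_w (\1_(g @^-1` [set r]) (Y w) * H w)%:E)%E.
  move=> mH H0.
  transitivity (\sum_(r \in range g)
      \int[P]_w (r * (\1_(g @^-1` [set r]) (Y w) * H w))%:E)%E.
    rewrite -ge0_integral_fsum//.
    - apply: eq_integral => w _; rewrite fsumEFin//; congr EFin.
      by rewrite gE mulr_fsuml; apply: eq_fsbigr => r _; rewrite mulrA.
    - move=> r; apply/measurable_EFinP/measurable_funM => //.
      by apply: measurable_funM => //; exact: mYB.
    - move=> r w _; rewrite mulrA lee_fin mulr_ge0//.
      by have := nnfun_muleindic_ge0 g r (Y w); rewrite -EFinM lee_fin.
  apply: eq_fsbigr => r /r_ge0 r0; under eq_integral do rewrite EFinM.
  rewrite ge0_integralZl_EFin//.
  - by move=> w _; rewrite lee_fin mulr_ge0// indicE.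
  - by apply/measurable_EFinP/measurable_funM => //; exact: mYB.
rewrite termwise//; under [RHS]eq_integral do rewrite mulrC.
rewrite (termwise (cst c))//; apply: eq_fsbigr => r _; congr (_ * _)%E.
rewrite indic//; under eq_integral do rewrite mulrC EFinM.
rewrite ge0_integralZl_EFin//.
- by rewrite integral_indic_RV.
- by apply/measurable_EFinP; exact: mYB.
Qed.

Lemma integral_weighted (Y : {RV P >-> R}) (G : T -> R) (c : R) (f : R -> R) :
    measurable_fun setT G -> (forall w, 0 <= G w) -> 0 <= c ->
    (forall B : set R, measurable B ->
      (\int[P]_w (\1_B (Y w) * G w)%:E = c%:E * P (Y @^-1` B))%E) ->
    measurable_fun setT f -> (forall y, 0 <= f y) ->
  (\int[P]_w (f (Y w) * G w)%:E = c%:E * \int[P]_w (f (Y w))%:E)%E.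
Proof.
move=> mG G0 c0 indic mf f0.
have mf' : measurable_fun setT (EFin \o f) by exact/measurable_EFinP.
pose f_ := nnsfun_approx measurableT mf'.
have mfY (g : R -> R) : measurable_fun setT g -> measurable_fun setT (fun w => g (Y w)).
  by move=> mg; exact: measurableT_comp.
have f_cvg w : (f_ n (Y w))%:E @[n --> \oo] --> (f (Y w))%:E.
  by apply: (cvg_nnsfun_approx measurableT mf') => // y _; rewrite lee_fin.
transitivity (limn (fun n => \int[P]_w (f_ n (Y w) * G w)%:E)%E).
  rewrite -monotone_convergence//.
  - apply: eq_integral => w _; apply/esym/cvg_lim => //.
    under eq_fun do rewrite EFinM; rewrite EFinM.
    by apply: cvgeZr.
  - by move=> n; apply/measurable_EFinP/measurable_funM => //; exact: mfY.
  - by move=> n w _; rewrite lee_fin mulr_ge0.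
  - move=> w _ m n mn; rewrite lee_fin ler_wpM2r//.
    exact/lefP/nd_nnsfun_approx.
rewrite -ge0_integralZl_EFin//; last 2 first.
- by move=> w _; rewrite lee_fin.
- by apply/measurable_EFinP; exact: mfY.
rewrite (_ : (fun _ => _) = (fun n => \int[P]_w (c * f_ n (Y w))%:E)%E); last first.
  by apply/funext => n; exact: integral_weighted_simple.
rewrite -monotone_convergence//.
- apply: eq_integral => w _; apply/cvg_lim => //.
  under eq_fun do rewrite EFinM; rewrite -EFinM EFinM.
  by apply: cvgeZl.
- by move=> n; apply/measurable_EFinP/measurable_funM => //; exact: mfY.
- by move=> n w _; rewrite lee_fin mulr_ge0.
- move=> w _ m n mn; rewrite lee_fin ler_wpM2l//.
  exact/lefP/nd_nnsfun_approx.
Qed.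

Lemma measurable_bigprod (I : Type) (s : seq I) (Q : pred I) (h : I -> T -> R) :
    (forall i, measurable_fun setT (h i)) ->
  measurable_fun setT (fun w => \prod_(i <- s | Q i) h i w).
Proof.
move=> mh; elim: s => [|i s IH].
  by under eq_fun do rewrite big_nil; exact: measurable_cst.
under eq_fun do rewrite big_cons; case: (Q i) => //.
exact: measurable_funM.
Qed.

(** Independence gives the formula when all the [f i] are indicators; they are
    then replaced one at a time by arbitrary nonnegative functions. *)
Lemma integral_prod_indep (I : finType) (Xs : I -> {RV P >-> R})
    (f : I -> R -> R) (e : I -> R) :
    (forall B : I -> set R, (forall i, measurable (B i)) ->
      P [set w | forall i, B i (Xs i w)] = (\prod_(i in I) P (Xs i @^-1` B i))%E) ->
    (forall i, measurable_fun setT (f i)) -> (forall i y, 0 <= f i y) ->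
    (forall i, (\int[P]_w (f i (Xs i w))%:E = (e i)%:E)%E) ->
  (\int[P]_w (\prod_i f i (Xs i w))%:E = (\prod_i e i)%:E)%E.
Proof.
move=> indep.
have mX i B : measurable B -> measurable (Xs i @^-1` B).
  by move=> mB; rewrite -[_ @^-1` _]setTI; exact: measurable_funP.
suff ind (s : seq I) : forall (f : I -> R -> R) (e : I -> R),
    (forall i, measurable_fun setT (f i)) -> (forall i y, 0 <= f i y) ->
    (forall i, (\int[P]_w (f i (Xs i w))%:E = (e i)%:E)%E) ->
    (forall i, i \notin s -> exists2 B, measurable B & f i = \1_B) ->
    (\int[P]_w (\prod_i f i (Xs i w))%:E = (\prod_i e i)%:E)%E.
  move=> mf f0 fe; apply: (ind (enum I)) => // i.
  by rewrite mem_enum.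
elim: s => [|i s IH] {}f {}e mf f0 fe fB.
  have {}fB i : {B | measurable B & f i = \1_B} by apply/cid2/fB.
  pose B (i : I) : set R := s2val (fB i).
  have mB i : measurable (B i) by exact: (s2valP (fB i)).
  have fE i : f i = \1_(B i) by exact: (s2valP' (fB i)).
  transitivity (\int[P]_w (\1_[set w | forall i, B i (Xs i w)] w)%:E)%E.
    apply: eq_integral => w _; congr EFin.
    under eq_bigr do rewrite fE indicE.
    rewrite indicE; have [/set_mem/= all|/negP nall] := boolP (w \in _).
      by rewrite big1// => i _; rewrite mem_set.
    have /existsNP[i nB] : ~ forall i, B i (Xs i w) by move=> h; apply: nall; rewrite inE.
    by rewrite (bigD1 i)//= memNset// mul0r.
  have -> : [set w | forall i, B i (Xs i w)] = \bigcap_(i in setT) (Xs i @^-1` B i).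
    by apply/seteqP; split => w /= h i => [_|]; apply: h.
  rewrite integral_indic//; last by apply: fin_bigcap_measurable => // i _; exact: mX.
  have <- : [set w | forall i, B i (Xs i w)] = \bigcap_(i in setT) (Xs i @^-1` B i).
    by apply/seteqP; split => w /= h i => [_|]; apply: h.
  rewrite setIT; apply: etrans; first exact: (indep B mB).
  rewrite -prodEFin; apply: eq_bigr => i _.
  by rewrite -integral_indic_RV// -fE fe.
pose G w := \prod_(j | j != i) f j (Xs j w).
have mG : measurable_fun setT G.
  apply: measurable_bigprod => j; exact: measurableT_comp.
have G0 w : 0 <= G w by apply: prodr_ge0.
have e0 j : 0 <= e j.
  by rewrite -lee_fin -fe; apply: integral_ge0 => w _; rewrite lee_fin.
under eq_integral do rewrite (bigD1 i)//= -/(G _).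
rewrite (integral_weighted (c := \prod_(j | j != i) e j)) ?prodr_ge0//.
  by rewrite fe -EFinM mulrC [in RHS](bigD1 i).
move=> B mB.
pose fB' j := if j == i then \1_B else f j.
pose eB' j := if j == i then fine (P (Xs i @^-1` B)) else e j.
have PB : (P (Xs i @^-1` B) = (fine (P (Xs i @^-1` B)))%:E)%E.
  by rewrite fineK// fin_num_measure//; exact: mX.
rewrite PB -EFinM -[in RHS](_ : eB' i = fine (P (Xs i @^-1` B))); last by rewrite /eB' eqxx.
have eB'E : \prod_(j | j != i) e j = \prod_(j | j != i) eB' j.
  by apply: eq_bigr => j /negbTE; rewrite /eB' => ->.
rewrite eB'E mulrC.
have -> : eB' i * \prod_(j | j != i) eB' j = \prod_j eB' j by rewrite [RHS](bigD1 i).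
rewrite -(IH fB' eB').
- apply: eq_integral => w _; congr EFin; rewrite [RHS](bigD1 i)//= /fB' eqxx.
  by congr (_ * _); apply: eq_bigr => j /negbTE ->.
- move=> j; rewrite /fB'; case: eqP => // _; exact: measurable_indic.
- by move=> j y; rewrite /fB'; case: eqP => // _; rewrite indicE.
- move=> j; rewrite /fB' /eB'; case: eqP => [->|//].
  by rewrite integral_indic_RV// -PB.
- move=> j js; rewrite /fB'; case: eqP => [_|/eqP ji]; first by exists B.
  by apply: fB; rewrite inE negb_or ji.
Qed.

Lemma measurable_pbtail (I : eqType) (Xs : I -> {RV P >-> R}) (p : R -> R)
    (l : seq I) (t : seq R) K : measurable_fun setT p ->
  measurable_fun setT (fun w => pbtail ([seq p (Xs i w) | i <- l] ++ t) K).
Proof.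
move=> mp; elim: l K => [|i l IH] K /=; first exact: measurable_cst.
under eq_fun do rewrite pbtail_cons.
have mpX : measurable_fun setT (fun w => p (Xs i w)) by exact: measurableT_comp.
apply: measurable_funD; apply: measurable_funM => //.
by apply: measurable_funB => //.
Qed.

(** The Poisson-binomial tail is affine in each success probability, so that
    independent random success probabilities may be replaced by their means.
    The induction expands one trial at a time, moving its factor [p] or [1 - p]
    into the product of the [f i]. *)
Lemma integral_pbtail (I : finType) (Xs : I -> {RV P >-> R}) (p : R -> R) (q : R)
    (t : seq R) K :
    (forall B : I -> set R, (forall i, measurable (B i)) ->
      P [set w | forall i, B i (Xs i w)] = (\prod_(i in I) P (Xs i @^-1` B i))%E) ->
    measurable_fun setT p -> (forall y, 0 <= p y <= 1) ->
    all (fun x => 0 <= x <= 1) t ->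
    (forall i, (\int[P]_w (p (Xs i w))%:E = q%:E)%E) ->
  (\int[P]_w (pbtail ([seq p (Xs i w) | i <- enum I] ++ t) K)%:E =
    (pbtail (nseq #|I| q ++ t) K)%:E)%E.
Proof.
move=> indep mp p01 t01 pq.
have p0 y : 0 <= p y by case/andP: (p01 y).
have p1 y : p y <= 1 by case/andP: (p01 y).
have mpX i : measurable_fun setT (fun w => p (Xs i w)) by exact: measurableT_comp.
have int1 : (\int[P]_w (1 : R)%:E = 1)%E.
  by rewrite integral_cst// mul1e; exact: probability_setT.
have q'E i : (\int[P]_w (1 - p (Xs i w))%:E = (1 - q)%:E)%E.
  have : (\int[P]_w ((p (Xs i w))%:E + (1 - p (Xs i w))%:E) = 1)%E.
    rewrite -int1; apply: eq_integral => w _.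
    by rewrite -EFinD; congr EFin; ring.
  rewrite ge0_integralD//.
  - by rewrite pq; case: (integral _ _ _) => // r [<-]; congr EFin; ring.
  - by move=> w _; rewrite lee_fin.
  - exact/measurable_EFinP.
  - by move=> w _; rewrite lee_fin subr_ge0.
  - by apply/measurable_EFinP/measurable_funB.
suff ind (l : seq I) : forall (f : I -> R -> R) (e : I -> R) K, uniq l ->
    (forall i, i \in l -> f i = cst 1) ->
    (forall i, measurable_fun setT (f i)) -> (forall i y, 0 <= f i y) ->
    (forall i, (\int[P]_w (f i (Xs i w))%:E = (e i)%:E)%E) ->
    (\int[P]_w (\prod_i f i (Xs i w) *
       pbtail ([seq p (Xs i w) | i <- l] ++ t) K)%:E =
     (\prod_i e i * pbtail (nseq (size l) q ++ t) K)%:E)%E.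
  pose f1 (i : I) (y : R) : R := 1; pose e1 (i : I) : R := 1.
  have f11 i : i \in enum I -> f1 i = cst 1 by [].
  have mf1 i : measurable_fun setT (f1 i) by exact: measurable_cst.
  have f10 i y : 0 <= f1 i y by exact: ler01.
  have f1e i : (\int[P]_w (f1 i (Xs i w))%:E = (e1 i)%:E)%E by exact: int1.
  have := ind (enum I) f1 e1 K (enum_uniq I) f11 mf1 f10 f1e.
  rewrite [\prod_i e1 i]big1// mul1r -cardE => <-.
  by apply: eq_integral => w _; rewrite mul1r.
elim: l => [|i l IH] f e L; rewrite /=.
  move=> _ _ mf f0 fe; under eq_integral do rewrite mulrC EFinM.
  rewrite ge0_integralZl_EFin//=.
  - by rewrite (integral_prod_indep indep mf f0 fe) -EFinM mulrC.
  - by move=> w _; rewrite lee_fin prodr_ge0.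
  - apply/measurable_EFinP/measurable_bigprod => j; exact: measurableT_comp.
  - exact: pbtail_ge0.
move=> /andP[il ul] f1 mf f0 fe.
have e1 : e i = 1.
  by have := fe i; rewrite f1 ?mem_head//= int1 => -[].
pose f' (g : R -> R) j := if j == i then g else f j.
pose e' (r : R) j := if j == i then r else e j.
have prod_f g w : \prod_j f' g j (Xs j w) = \prod_j f j (Xs j w) * g (Xs i w).
  rewrite (bigD1 i)//= [X in _ = X * _](bigD1 i)//= /f' eqxx f1 ?mem_head// mul1r mulrC.
  by congr (_ * _); apply: eq_bigr => j /negbTE ->.
have prod_e r : \prod_j e' r j = \prod_j e j * r.
  rewrite (bigD1 i)//= [X in _ = X * _](bigD1 i)//= /e' eqxx e1 mul1r mulrC.
  by congr (_ * _); apply: eq_bigr => j /negbTE ->.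
have IH' (g : R -> R) r M : measurable_fun setT g -> (forall y, 0 <= g y) ->
    (\int[P]_w (g (Xs i w))%:E = r%:E)%E ->
    (\int[P]_w (\prod_j f j (Xs j w) * g (Xs i w) *
       pbtail ([seq p (Xs j w) | j <- l] ++ t) M)%:E =
     (\prod_j e j * r * pbtail (nseq (size l) q ++ t) M)%:E)%E.
  move=> mg g0 gr; rewrite -prod_e -(IH (f' g) (e' r) M ul).
  - by apply: eq_integral => w _; rewrite prod_f.
  - move=> j jl; rewrite /f'; case: eqP => [ji|_]; first by rewrite -ji jl in il.
    by rewrite f1// inE jl orbT.
  - by move=> j; rewrite /f'; case: eqP.
  - by move=> j y; rewrite /f'; case: eqP.
  - by move=> j; rewrite /f' /e'; case: eqP => [->|].
rewrite pbtail_cons.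
transitivity (\int[P]_w ((\prod_j f j (Xs j w) * p (Xs i w) *
      pbtail ([seq p (Xs j w) | j <- l] ++ t) L.-1)%:E +
    (\prod_j f j (Xs j w) * (1 - p (Xs i w)) *
      pbtail ([seq p (Xs j w) | j <- l] ++ t) L)%:E))%E.
  by apply: eq_integral => w _; rewrite pbtail_cons -EFinD; congr EFin; ring.
have pb0 w M : 0 <= pbtail ([seq p (Xs j w) | j <- l] ++ t) M.
  apply: pbtail_ge0; rewrite all_cat t01 andbT all_map; apply/allP => j _ /=.
  by rewrite p0 p1.
have mprod : measurable_fun setT (fun w => \prod_j f j (Xs j w)).
  by apply: measurable_bigprod => j; exact: measurableT_comp.
rewrite ge0_integralD//.
- rewrite (IH' p q)// (IH' (fun y => 1 - p y) (1 - q))//.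
  + by rewrite -EFinD; congr EFin; ring.
  + exact: measurable_funB.
  + by move=> y; rewrite subr_ge0.
- by move=> w _; rewrite lee_fin !mulr_ge0 ?prodr_ge0.
- apply/measurable_EFinP/measurable_funM; last exact: measurable_pbtail.
  exact: measurable_funM.
- by move=> w _; rewrite lee_fin !mulr_ge0 ?prodr_ge0 ?subr_ge0.
- apply/measurable_EFinP/measurable_funM; last exact: measurable_pbtail.
  by apply: measurable_funM => //; exact: measurable_funB.
Qed.

End Independence.

(** * Randomized rounding of bounded variables *)

Section Randomization.
Context (d : measure_display) (T : measurableType d) (R : realType).
Context (P : probability T R).

(** The success probability [(1 + y) / 2], truncated so that it lies in [0, 1]
    everywhere and not only almost surely. *)
Definition clip (y : R) : R := Num.max 0 (Num.min 1 ((1 + y) / 2)).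

Lemma clip_itv y : 0 <= clip y <= 1.
Proof.
by rewrite /clip le_max lexx /= ge_max ler01 ge_min lexx.
Qed.

Lemma clipE y : `|y| <= 1 -> clip y = (1 + y) / 2.
Proof. by rewrite ler_norml /clip => /andP[y1 y2]; rewrite min_r ?max_r; lra. Qed.

Lemma measurable_clip : measurable_fun setT clip.
Proof.
apply: measurable_maxr => //; apply: measurable_minr => //.
by apply: measurable_funM => //; apply: measurable_funD.
Qed.

(** [clip X - (1 - clip X)] equals [X] almost surely, and the two terms have
    integrals of sum 1 and difference 0. *)
Lemma integral_clip_centered (X : {RV P >-> R}) :
    P [set w | `|X w| <= 1] = 1%E -> ('E_P[X] = 0)%E ->
  (\int[P]_w (clip (X w))%:E = (2^-1)%:E)%E.
Proof.
move=> X1 X0; pose p w := clip (X w).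
have mp : measurable_fun setT p by apply: measurableT_comp => //; exact: measurable_clip.
have p01 w : 0 <= p w <= 1 by exact: clip_itv.
have bounded_int (f : T -> R) : measurable_fun setT f -> (forall w, 0 <= f w <= 1) ->
    P.-integrable setT (EFin \o f).
  move=> mf f01; apply: (@le_integrable _ _ _ _ _ _ _ (EFin \o cst 1)) => //.
  - exact/measurable_EFinP.
  - by move=> w _; have /andP[f0 f1] := f01 w; rewrite /= lee_fin !ger0_norm.
  - exact: finite_measure_integrable_cst.
have mq : measurable_fun setT (fun w => 1 - p w) by exact: measurable_funB.
have q01 w : 0 <= 1 - p w <= 1 by have := p01 w; lra.
have ip := bounded_int _ mp p01; have iq := bounded_int _ mq q01.
have mean : (\int[P]_w (p w)%:E - \int[P]_w (1 - p w)%:E = 0)%E.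
  rewrite -integralB_EFin// -[RHS]X0 expectation_def.
  apply: ae_eq_integral => //.
  - by apply: emeasurable_funB; exact/measurable_EFinP.
  - exact/measurable_EFinP.
  - have mA : measurable [set w | `|X w| <= 1].
      rewrite (_ : [set w | _] = X @^-1` `[-1, 1]%classic).
        by rewrite -[_ @^-1` _]setTI; exact: measurable_funP.
      by apply/seteqP; split => w /=; rewrite in_itv/= ler_norml.
    exists (~` [set w | `|X w| <= 1]); split.
    + exact: measurableC.
    + by apply: etrans; [exact: probability_setC|rewrite X1 subee].
    + apply: subsetC => w /= Xw _.
      by rewrite -EFinB /p clipE//; congr EFin; field.
have total : (\int[P]_w (p w)%:E + \int[P]_w (1 - p w)%:E = 1)%E.
  rewrite -ge0_integralD//.
  - under eq_integral do rewrite -EFinD addrC subrK.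
    by rewrite integral_cst// mul1e; exact: probability_setT.
  - by move=> w _; rewrite lee_fin; case/andP: (p01 w).
  - exact/measurable_EFinP.
  - by move=> w _; rewrite lee_fin; case/andP: (q01 w).
  - exact/measurable_EFinP.
move: mean total; have := integrable_fin_num measurableT ip.
have := integrable_fin_num measurableT iq; rewrite /=.
move: (\int[P]_w (p w)%:E)%E (\int[P]_w (1 - p w)%:E)%E => [u| |] [v| |]//= _ _.
move=> [uv] [uv1]; congr EFin; lra.
Qed.

Lemma integral_clip_identically (X Y : {RV P >-> R}) :
    (forall B : set R, measurable B -> distribution P X B = distribution P Y B) ->
  (\int[P]_w (clip (X w))%:E = \int[P]_w (clip (Y w))%:E)%E.
Proof.
move=> XY.
have mc : measurable_fun [set: R] (EFin \o clip).
  by apply/measurable_EFinP; exact: measurable_clip.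
have c0 y : (0 <= (EFin \o clip) y)%E by rewrite lee_fin; case/andP: (clip_itv y).
transitivity (\int[P]_w ((EFin \o clip) \o X) w)%E => //.
rewrite -ge0_integral_distribution// -[RHS]/(\int[P]_w ((EFin \o clip) \o Y) w)%E.
rewrite -ge0_integral_distribution//; apply: eq_measure_integral => B mB _.
exact: XY.
Qed.

End Randomization.

(** * The comparison and the interpolation *)

Section Comparison.
Context (d : measure_display) (T : measurableType d) (R : realType).
Context (P : probability T R).

Lemma measurable_sum_tail n (Xs : 'I_n -> {RV P >-> R}) (c : R) :
  measurable [set w | c <= \sum_(i < n) Xs i w].
Proof.
have mS : measurable_fun setT (fun w => \sum_(i < n) Xs i w).
  by apply: measurable_sum => i.
rewrite (_ : [set w | _] = (fun w => \sum_(i < n) Xs i w) @^-1` `[c, +oo[%classic).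
  by rewrite -[_ @^-1` _]setTI; exact: mS.
by apply/seteqP; split => w /=; rewrite in_itv/= andbT.
Qed.

(** Given the values of [Xs], trials with success probabilities [clip (Xs i w)]
    and one more with [1 - theta] have, on the event, a total mean of at least
    [m.+1]; they then yield [m.+1] successes with probability at least 1/2. *)
Lemma sum_tail_le_binomial n (Xs : 'I_n -> {RV P >-> R}) (m : nat) (theta : R) :
    (forall B : 'I_n -> set R, (forall i, measurable (B i)) ->
      P [set w | forall i, B i (Xs i w)] =
      (\prod_(i in 'I_n) P (Xs i @^-1` B i))%E) ->
    (forall i, P [set w | `|Xs i w| <= 1] = 1%E) ->
    (forall i, (\int[P]_w (clip (Xs i w))%:E = (2^-1)%:E)%E) ->
    0 <= theta <= 1 ->
  (P [set w | (2 * (m%:R + theta) - n%:R <= \sum_(i < n) Xs i w)%R] <=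
    (2 * ((1 - theta) * bintail n m + theta * bintail n m.+1))%:E)%E.
Proof.
move=> indep X1 Xp /andP[th0 th1].
set A := [set w | _]; pose t := [:: 1 - theta].
have mA : measurable A by exact: measurable_sum_tail.
pose D := [set w | forall i, `[-1, 1]%classic (Xs i w)].
have mD : measurable D.
  rewrite (_ : D = \bigcap_(i in setT) (Xs i @^-1` `[-1, 1]%classic)).
    apply: fin_bigcap_measurable => // i _.
    by rewrite -[_ @^-1` _]setTI; exact: measurable_funP.
  by apply/seteqP; split => w /= h i => [_|]; apply: h.
have PD : P D = 1%E.
  apply: etrans; first exact: (indep (fun=> `[-1, 1]%classic) (fun=> measurable_itv _)).
  rewrite big1// => i _; rewrite -(X1 i); congr (P _).
  by apply/seteqP; split => w /=; rewrite in_itv/= ler_norml.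
pose pb w := pbtail ([seq clip (Xs i w) | i <- enum 'I_n] ++ t) m.+1.
have unit_itv_list w : all (fun x => 0 <= x <= 1) ([seq clip (Xs i w) | i <- enum 'I_n] ++ t).
  rewrite all_cat all_map /= andbT; apply/andP; split; last by lra.
  by apply/allP => i _; exact: clip_itv.
have pb0 w : 0 <= pb w by apply: pbtail_ge0; exact: unit_itv_list.
have mpb : measurable_fun setT pb by apply: measurable_pbtail; exact: measurable_clip.
have pb_half w : A w -> D w -> 1 <= 2 * pb w.
  move=> Aw Dw; suff : 2^-1 <= pb w by lra.
  apply: half_le_pbtail; first exact: unit_itv_list.
  rewrite big_cat big_map big_enum big_seq1 /=.
  have -> : \sum_(i in 'I_n) clip (Xs i w) = (n%:R + \sum_(i < n) Xs i w) / 2.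
    rewrite mulrDl mulr_suml -[n in n%:R](card_ord n) -sumr_const mulr_suml -big_split/=.
    apply: eq_bigr => i _; rewrite clipE; first by field.
    by rewrite ler_norml; have := Dw i; rewrite /= in_itv.
  by move: Aw; rewrite /A /= -[m.+1%:R]natr1; lra.
have int_pb : (\int[P]_w (2 * pb w)%:E =
    (2 * ((1 - theta) * bintail n m + theta * bintail n m.+1))%:E)%E.
  under eq_integral do rewrite EFinM.
  rewrite ge0_integralZl_EFin//.
  - rewrite (integral_pbtail _ indep (@measurable_clip R) (@clip_itv R) _ Xp); last first.
      by rewrite /= andbT; lra.
    rewrite -EFinM card_ord; congr (2 * _)%:E.
    rewrite (@pbtail_perm _ _ (1 - theta :: nseq n 2^-1)); last first.
      by rewrite perm_catC.
    by rewrite pbtail_cons /bintail; ring.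
  - by move=> w _; rewrite lee_fin.
  - exact/measurable_EFinP.
rewrite -int_pb.
apply: (@le_trans _ _ (P (A `&` D))).
  have AD : A `<=` (A `&` D) `|` ~` D.
    by move=> w Aw; have [Dw|nDw] := pselect (D w); [left|right].
  have mAD : measurable (A `&` D) by exact: measurableI.
  have mDC : measurable (~` D) by exact: measurableC.
  apply: (@le_trans _ _ (P ((A `&` D) `|` ~` D))).
    by apply: le_measure; rewrite ?inE//; exact: measurableU.
  apply: le_trans (measureU2 _ mAD mDC) _.
  have PDC : P (~` D) = 0%E.
    by apply: etrans; [exact: probability_setC|rewrite PD subee].
  rewrite -[leRHS]adde0; apply: leeD => //.
  by rewrite le_eqVlt; apply/orP; left; apply/eqP.
rewrite -[X in P X]setIT -integral_indic//; last exact: measurableI.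
apply: ge0_le_integral => //.
- by apply/measurable_EFinP/measurable_indic; exact: measurableI.
- by apply/measurable_EFinP/measurable_funM.
- move=> w _; rewrite lee_fin indicE.
  case: (boolP (w \in A `&` D)) => [/set_mem [Aw Dw]|_]; first exact: pb_half.
  by rewrite mulr_ge0.
Qed.

End Comparison.

Section Lattice.
Context {R : realType}.

Lemma lattice_interpolation_segment n (m : nat) (f g : R -> R) (theta : R) : (0 < n)%N ->
  linear_interpolation (lattice R n) f g -> 0 <= theta <= 1 ->
  g ((2 * (m%:R + theta) - n%:R) / Num.sqrt n%:R) =
    (1 - theta) * f ((2 * m%:R - n%:R) / Num.sqrt n%:R) +
    theta * f ((2 * m.+1%:R - n%:R) / Num.sqrt n%:R).
Proof.
move=> n0 [_ gL gA] /andP[th0 th1].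
have s0 : 0 < Num.sqrt n%:R :> R by rewrite sqrtr_gt0 ltr0n.
pose pt (j : nat) : R := (2 * j%:R - n%:R) / Num.sqrt n%:R.
pose F := Num.floor (n%:R / 2 : R).
(* the shift j - n + F cancels the offset of the lattice *)
have ptL j : lattice R n (pt j).
  exists (j%:Z - n%:Z + F) => //.
  by rewrite -/F intrD intrB -!pmulrn /pt; field; rewrite gt_eqF.
have step : pt m < pt m.+1.
  by rewrite ltr_pM2r ?invr_gt0// ltrD2r ltr_pM2l// ltr_nat.
have cons_pt : consecutive (lattice R n) (pt m) (pt m.+1).
  split => // _ [k _ <-]; rewrite -/F => /andP[].
  rewrite /pt ltr_pdivrMr// ltr_pdivlMr//.
  have -> : 2 / Num.sqrt n%:R * (n%:R / 2 - F%:~R + k%:~R) * Num.sqrt n%:R =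
      2 * (k - F + n%:Z)%:~R - n%:R :> R.
    by rewrite intrD intrB -pmulrn; field; rewrite gt_eqF.
  rewrite !ltrD2r !ltr_pM2l// -[m%:R]/(m%:Z%:~R) -[m.+1%:R]/(m.+1%:Z%:~R) !ltr_int.
  by lia.
have [c [e gE]] := gA _ _ cons_pt.
have xE : (2 * (m%:R + theta) - n%:R) / Num.sqrt n%:R =
    (1 - theta) * pt m + theta * pt m.+1.
  by rewrite /pt -natr1; ring.
rewrite xE -/(pt m) -/(pt m.+1) -(gL _ (ptL m)) -(gL _ (ptL m.+1)).
have le_step := ltW step.
rewrite (gE (pt m)) ?lexx// (gE (pt m.+1)) ?lexx ?le_step// gE; first by ring.
by apply/andP; split; nra.
Qed.

End Lattice.

Theorem corollary1p3 (d : measure_display) (T : measurableType d)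
    (R : realType) (P : probability T R) (n : nat) (n_gt0 : (0 < n)%N)
    (X : {RV P >-> R}) (Xs : 'I_n -> {RV P >-> R})
    (X_iid : iid (ocons X Xs))
    (X_bounded : P [set w | `|X w| <= 1] = 1%E)
    (X_centered : ('E_P[X] = 0)%E)
    (Qhat : R -> R)
    (Qhat_interp : linear_interpolation (lattice R n) Qfun Qhat)
    (x : R) (x_ge0 : 0 <= x) :
  (P [set w | (x <= (\sum_(i < n) Xs i w) / Num.sqrt n%:R)%R] <=
    (2 * Qhat x)%:E)%E.
Proof.
have [indep0 same] := X_iid.
have s0 : 0 < Num.sqrt n%:R :> R by rewrite sqrtr_gt0 ltr0n.
have indep (B : 'I_n -> set R) : (forall i, measurable (B i)) ->
    P [set w | forall i, B i (Xs i w)] =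
    (\prod_(i in 'I_n) P (Xs i @^-1` B i))%E.
  move=> mB; pose B' (o : option 'I_n) : set R := if o is Some i then B i else setT.
  have mB' o : measurable (B' o) by case: o => [i|] //=; exact: mB.
  have := indep0 [set Some i | i : 'I_n]%SET B' mB'.
  rewrite big_imset/=; last by move=> i j _ _ [].
  move=> <-; congr (P _); apply/seteqP; split => w /= h.
    by move=> _ /imsetP[i _ ->]; exact: h.
  by move=> i; apply: (h (Some i)); apply/imsetP; exists i.
have Xs_bounded i : P [set w | `|Xs i w| <= 1] = 1%E.
  rewrite -X_bounded.
  have := same (Some i) None `[-1, 1]%classic (measurable_itv _).
  rewrite /distribution /pushforward /= => h.
  have E (Y : T -> R) : [set w | `|Y w| <= 1] = Y @^-1` `[-1, 1]%classic.
    by apply/seteqP; split => w /=; rewrite in_itv/= ler_norml.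
  by rewrite !E.
have Xs_mean i : (\int[P]_w (clip (Xs i w))%:E = (2^-1)%:E)%E.
  rewrite -(integral_clip_centered X_bounded X_centered).
  by apply: integral_clip_identically => B mB; exact: (same (Some i) None).
pose y : R := (n%:R + x * Num.sqrt n%:R) / 2.
have y0 : 0 <= y by rewrite divr_ge0// addr_ge0// mulr_ge0 ?sqrtr_ge0.
pose m := Num.truncn y; have /andP[my ym] := truncn_itv y0.
rewrite -/m in my ym; pose theta := y - m%:R.
have th01 : 0 <= theta <= 1 by move: ym; rewrite /theta -natr1; lra.
have xE : x = (2 * (m%:R + theta) - n%:R) / Num.sqrt n%:R.
  by rewrite /theta /y; field; rewrite gt_eqF.
rewrite {2}xE (lattice_interpolation_segment m n_gt0 Qhat_interp th01).
set a := (2 * m%:R - _) / _; set b := (2 * m.+1%:R - _) / _.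
have eventE : [set w | x <= (\sum_(i < n) Xs i w) / Num.sqrt n%:R] =
    [set w | 2 * (m%:R + theta) - n%:R <= \sum_(i < n) Xs i w].
  by apply/seteqP; split => w /=; rewrite xE ler_pM2r ?invr_gt0.
rewrite eventE; have [nm|mn] := leqP n m.*2.
  apply: (@le_trans _ _ (2 * ((1 - theta) * bintail n m + theta * bintail n m.+1))%:E).
    exact: sum_tail_le_binomial.
  have natE j : (n <= j.*2)%N -> 2 * j%:R - n%:R = (j.*2 - n)%:R :> R.
    by move=> nj; rewrite natrB// -muln2 natrM mulrC.
  have Ta : bintail n m <= Qfun a by rewrite /a natE//; exact: bintail_le_Qfun.
  have Tb : bintail n m.+1 <= Qfun b.
    rewrite /b natE; last by lia.
    by apply: bintail_le_Qfun => //; lia.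
  case/andP: th01 => th0 th1.
  by rewrite lee_fin ler_wpM2l// lerD// ler_wpM2l// subr_ge0.
(* the remaining segment joins - 1 / sqrt n to 1 / sqrt n *)
have mn' : n = m.*2.+1.
  apply/eqP; rewrite eqn_leq mn andbT.
  have : n%:R < 2 * m.+1%:R :> R.
    have : 0 <= x * Num.sqrt n%:R by rewrite mulr_ge0 ?sqrtr_ge0.
    by move: ym; rewrite /y; lra.
  by rewrite -natrM ltr_nat; lia.
have s1 : 1 <= Num.sqrt n%:R :> R by rewrite -[leLHS]sqrtr1 ler_sqrt ?ltr0n// ler1n.
have nE : n%:R = 2 * m%:R + 1 :> R by rewrite mn' -addn1 natrD -muln2 natrM mulrC.
have Qa : 2^-1 <= Qfun a.
  apply: half_le_Qfun; rewrite normrM normfV (ger0_norm (ltW s0)) ler_pdivrMr// mul1r.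
  apply: le_trans s1; rewrite nE.
  by rewrite (_ : _ - _ = -1) ?normrN1//; ring.
have Qb : 2^-1 <= Qfun b.
  apply: half_le_Qfun; rewrite normrM normfV (ger0_norm (ltW s0)) ler_pdivrMr// mul1r.
  apply: le_trans s1; rewrite nE -[m.+1%:R]natr1.
  by rewrite (_ : _ - _ = 1) ?normr1//; ring.
apply: (@le_trans _ _ 1%E).
  by apply: probability_le1; exact: measurable_sum_tail.
case/andP: th01 => th0 th1.
have : 0 <= (1 - theta) * (Qfun a - 2^-1) by rewrite mulr_ge0 ?subr_ge0.
have : 0 <= theta * (Qfun b - 2^-1) by rewrite mulr_ge0 ?subr_ge0.
rewrite lee_fin; lra.
Qed.
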